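(* Let $H=\sum_{\gamma=1}^{\Gamma}H_\gamma$ be a Hamiltonian on a system of fermionic modes on a lattice, where each $H_\gamma=J^{(\gamma)}\sum_{\vec j}h^{(\gamma)}_{\vec j}$ is translation invariant, each $h^{(\gamma)}_{\vec j}$ is a number-preserving fermionic operator (NPFO) with locality $k^{(\gamma)}$, and for each fixed $\gamma$ the terms $h^{(\gamma)}_{\vec j}$ have pairwise disjoint supports. Then the error of the $p$th-order product formula $\mathcal P_p(t)$ for this decomposition satisfies $$\big\|e^{-itH}-\mathcal P_p(t)\big\|_\eta=O\big(t^{p+1}\eta\big),$$ where the implied constant depends only on $p$, $\Gamma$, the $J^{(\gamma)}$ and the $k^{(\gamma)}$ (in particular not on the lattice size, $\eta$ or $t$).
   Context: Fermionic modes $i$ on a lattice have annihilation/creation operators $a(i),a^\dagger(i)$ with the canonical anticommutation relations, and $N(i)=a^\dagger(i)a(i)$. NPFO: for a tuple $\vec i=(i_1,\dots,i_k)$ of pairwise distinct modes, a number-preserving fermionic operator is $h_{\vec i}=a^\dagger(i_1)\cdots a^\dagger(i_m)\,a(i_{m+1})\cdots a(i_{2m})\,N(i_{2m+1})\cdots N(i_k)$. Its support is $\{i_1,\dots,i_k\}$ and its locality is $k$. Translation invariance of $H_\gamma$ means that all its terms are lattice translates of one another, with $\vec j$ ranging over a translation-invariant family of tuples of modes. Fermionic semi-norm: $\|X\|_\eta=\max|\langle\psi_\eta|X|\phi_\eta\rangle|$ over normalized states $\psi_\eta,\phi_\eta$ with exactly $\eta$ fermions. Product formulae: $\mathcal P_1(t)=\prod_{\gamma=1}^{\Gamma}e^{-itH_\gamma}$;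 $\mathcal P_2(t)=\prod_{\gamma=1}^{\Gamma}e^{-itH_\gamma/2}\prod_{\gamma=\Gamma}^{1}e^{-itH_\gamma/2}$; and for even $p\ge2$, $\mathcal P_{p+2}(t)=\mathcal P_p(s_pt)^2\,\mathcal P_p((1-4s_p)t)\,\mathcal P_p(s_pt)^2$ with $s_p=(4-4^{1/(p+1)})^{-1}$. So $p\in\{1\}\cup 2\mathbb N$.
   Formalization: The bound is stated for all t ≥ 0 when every H_γ is Hermitian (terms may be an NPFO plus its Hermitian conjugate), and otherwise only for tη ≤ 1; for non-Hermitian H_γ, e.g. one-directional hopping layers, the uniform bound fails. The J^(γ) are real. *)

(* Defs.v *)
From HB Require Import structures.
From mathcomp Require Import all_boot all_order all_algebra.
From mathcomp Require Import spectral.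
From mathcomp Require Import complex.
From mathcomp Require Import boolp classical_sets reals topology normedtype.
From mathcomp Require Import sequences exp.

Set Implicit Arguments.
Unset Strict Implicit.
Unset Printing Implicit Defensive.

Import Order.TTheory GRing.Theory Num.Theory.
Import numFieldNormedType.Exports.

Local Open Scope classical_set_scope.
Local Open Scope ring_scope.
Local Open Scope sesquilinear_scope.

(* e^A = \sum_k A^k / k!, as the entrywise limit of the partial sums. Taking the
   limits of real and imaginary parts keeps all topology on [R]. *)
Definition mexp (R : realType) (D : nat) (A : 'M[R[i]]_D) : 'M[R[i]]_D :=
  let S n := \sum_(k < n) (k`!%:R)^-1 *: A ^+ k in
  \matrix_(r, c) Complex (limn (fun n => complex.Re (S n r c)))
                         (limn (fun n => complex.Im (S n r c))).

(* e^{-itA} *)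
Definition evol (R : realType) (D : nat) (A : 'M[R[i]]_D) (t : R) :
    'M[R[i]]_D :=
  mexp ((Complex 0 (- t)) *: A).

(* The [a x] are the annihilation operators, in any finite-dimensional
   representation; [(a x)^t*] is the creation operator of mode [x]. The Fock
   space of the modes of [M] is the case [D = 2 ^ #|M|]. *)
Definition CAR (R : realType) (M : finType) (D : nat) (a : M -> 'M[R[i]]_D) :
    Prop :=
  (forall x y, a x * a y + a y * a x = 0) /\
  (forall x y, a x * (a y)^t* + (a y)^t* * a x = (x == y)%:R).

Definition number_op (R : realType) (M : finType) (D : nat)
    (a : M -> 'M[R[i]]_D) (x : M) : 'M[R[i]]_D :=
  (a x)^t* * a x.

(* a^*(i_1) .. a^*(i_m) a(i_{m+1}) .. a(i_{2m}) N(i_{2m+1}) .. N(i_k) for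
   s = [:: i_1; ..; i_k], the factors being in this order. *)
Definition npfo (R : realType) (M : finType) (D : nat) (a : M -> 'M[R[i]]_D)
    (m : nat) (s : seq M) : 'M[R[i]]_D :=
  \prod_(x <- take m s) (a x)^t* *
  \prod_(x <- take m (drop m s)) a x *
  \prod_(x <- drop m.*2 s) number_op a x.

(* An NPFO with m > 0 is not self-adjoint; with [hc = true] it is completed by
   its Hermitian conjugate, as in the hopping term a^*(x) a(y) + a^*(y) a(x). *)
Definition npfo_term (R : realType) (M : finType) (D : nat)
    (a : M -> 'M[R[i]]_D) (hc : bool) (m : nat) (s : seq M) : 'M[R[i]]_D :=
  if hc then npfo a m s + (npfo a m s)^t* else npfo a m s.

(* H_gamma = J \sum_{j in F} h_j *)
Definition ham_layer (R : realType) (M : finType) (D : nat)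
    (a : M -> 'M[R[i]]_D) (J : R) (hc : bool) (m k : nat)
    (F : {set k.-tuple M}) : 'M[R[i]]_D :=
  (Complex J 0) *: \sum_(s in F) npfo_term a hc m s.

(* [V] is the group of lattice vectors and [pos] gives the site and the internal
   label (spin, orbital) of each mode. *)
Definition translate_of (V : zmodType) (B : Type) (M : finType)
    (pos : M -> V * B) (k : nat) (v : V) (s s' : k.-tuple M) : Prop :=
  forall n : 'I_k,
    pos (tnth s' n) = ((pos (tnth s n)).1 + v, (pos (tnth s n)).2).

(* All tuples of the family are translates of one another, and the family is
   closed under every translation of a group [L] that stays inside the finite
   set of modes. [L] may be a proper sublattice: a family such as the hopping
   terms on every other bond is only invariant under a sublattice, and
   invariance under all translations is rarely compatible with disjoint
   supports. *)
Definition translation_invariant (V : zmodType) (B : Type) (M : finType)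
    (pos : M -> V * B) (k : nat) (F : {set k.-tuple M}) : Prop :=
  exists2 L : {pred V}, zmod_closed L &
    forall s, s \in F -> forall s',
      s' \in F <-> exists2 v, v \in L & translate_of pos v s s'.

Definition disjoint_supports (M : finType) (k : nat) (F : {set k.-tuple M}) :
    Prop :=
  forall s s' : k.-tuple M, s \in F -> s' \in F -> s <> s' -> ~~ has [in s] s'.

(* Normalized states with exactly eta fermions. *)
Definition fermion_state (R : realType) (M : finType) (D : nat)
    (a : M -> 'M[R[i]]_D) (eta : nat) (psi : 'cV[R[i]]_D) : Prop :=
  psi^t* *m psi = 1%:M /\
  (\sum_(x : M) number_op a x) *m psi = eta%:R *: psi.

(* The set is bounded and the supremum is attained, except that there are no
   states with eta > #|M|, in which case the value is [sup set0 = 0]. *)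
Definition eta_norm (R : realType) (M : finType) (D : nat)
    (a : M -> 'M[R[i]]_D) (eta : nat) (X : 'M[R[i]]_D) : R :=
  sup [set r : R | exists psi phi : 'cV[R[i]]_D,
        [/\ fermion_state a eta psi, fermion_state a eta phi &
            r = ComplexField.Normc.normc ((psi^t* *m X *m phi) ord0 ord0)]].

(* The products are ordered: the factor of index 0 is leftmost. *)
Definition PF1 (R : realType) (D G : nat) (H : 'I_G -> 'M[R[i]]_D) (t : R) :
    'M[R[i]]_D :=
  \prod_(g < G) evol (H g) t.

Definition PF2 (R : realType) (D G : nat) (H : 'I_G -> 'M[R[i]]_D) (t : R) :
    'M[R[i]]_D :=
  \prod_(g < G) evol (H g) (t / 2) * \prod_(g < G) evol (H (rev_ord g)) (t / 2).

Definition suzuki_coef (R : realType) (p : nat) : R :=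
  (4 - 4 `^ (p.+1%:R)^-1)^-1.

(* [PFeven H n] is the formula of order [n.+1.*2]. *)
Fixpoint PFeven (R : realType) (D G : nat) (H : 'I_G -> 'M[R[i]]_D) (n : nat)
    (t : R) : 'M[R[i]]_D :=
  if n is n'.+1 then
    let s := suzuki_coef R n'.+1.*2 in
    PFeven H n' (s * t) ^+ 2 * PFeven H n' ((1 - 4 * s) * t) *
    PFeven H n' (s * t) ^+ 2
  else PF2 H t.

Definition product_order (p : nat) : Prop := p = 1%N \/ (0 < p)%N /\ ~~ odd p.

(* Meaningful for [product_order p]. *)
Definition product_formula (R : realType) (D G : nat) (H : 'I_G -> 'M[R[i]]_D)
    (p : nat) (t : R) : 'M[R[i]]_D :=
  if p == 1%N then PF1 H t else PFeven H p./2.-1 t.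

(* Main.v *)
(* Put X_g = - i H_g. A product formula P(t) is a product of exponentials of multiples
   t c_j X_(g_j), the list of pairs (c_j, g_j) depending on p and Gamma only, and it solves
   P' = G P, where G is a sum of the c_j X_(g_j) conjugated by exponentials. Expanding the
   conjugations one at a time writes G as a polynomial in t of degree < p plus a remainder
   O(t^p) which involves only conjugates of p-fold nested commutators of the X_g. The order
   conditions, an identity of formal power series that follows Suzuki's recursion, say that
   the polynomial is X = \sum_g X_g. Hence e^(-tX) P(t) has derivative O(t^p) on the
   eta-fermion sector, with the size of the nested commutators as a factor.
   As the terms of a layer have disjoint supports, a nested commutator is a sum of local
   number-preserving operators whose norms, supports and overlaps are bounded. Each of them
   vanishes unless its support contains a fermion, so by Cauchy-Schwarz the sum is O(eta) on
   the sector. The exponentials are bounded there because the layers are Hermitian or,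
   otherwise, because they are O(eta) themselves and t eta <= 1. *)

Require Import Defs.
From mathcomp Require Import all_boot all_order all_algebra.
From mathcomp Require Import spectral.
From mathcomp Require Import complex.
From mathcomp Require Import boolp classical_sets functions reals topology normedtype.
From mathcomp Require Import sequences derive realfun exp.
From mathcomp Require Import ring lra.

Set Implicit Arguments.
Unset Strict Implicit.
Unset Printing Implicit Defensive.

Import Order.TTheory GRing.Theory Num.Theory.
Import numFieldNormedType.Exports.

Local Open Scope ring_scope.
Local Open Scope sesquilinear_scope.
Local Open Scope complex_scope.

(** Bounding the Taylor remainders of the two propagators directly would cost a factor of order eta
    for every power of H, hence eta^(p+1). A commutator of two sums of local terms is again such a
    sum, so nested commutators stay linear in eta; every remainder is therefore carried as a
    conjugated commutator and only estimated at depth p.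

    The constant is chosen before the lattice, the dimension and the sector. So all bounds are
    explicit recursions ([coef_cst], [rem_cst], [nested_cst]) whose data are p, the list of factors,
    J and k.

    The middle step of Suzuki's recursion has the negative coefficient 1 - 4s, and conjugations
    involve inverses, so exponentials must be bounded for both signs of the time.

    The generator is computed twice by the same recursion: as a polynomial with noncommutative
    coefficients ([fG]), where the order conditions are pure algebra, and as a matrix function
    ([gen]). Their difference is the remainder. It is estimated without integrals: differentiation
    lowers the commutator depth still to be expanded, and the mean value theorem restores a power of
    t. *)

Notation normc := ComplexField.Normc.normc.

(** * Vectors and norms *)

Section Vectors.
Variable R : realType.
Local Notation C := R[i].
Local Notation Re := (@complex.Re R).
Local Notation Im := (@complex.Im R).
Implicit Types z : C.

Lemma cReD z (w : C) : Re (z + w) = Re z + Re w.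
Proof. by case: z; case: w. Qed.

Lemma cImD z (w : C) : Im (z + w) = Im z + Im w.
Proof. by case: z; case: w. Qed.

Lemma cReM z (w : C) : Re (z * w) = Re z * Re w - Im z * Im w.
Proof. by case: z; case: w. Qed.

Lemma cImM z (w : C) : Im (z * w) = Re z * Im w + Im z * Re w.
Proof. by case: z => a b; case: w => c d /=; rewrite [b * c]mulrC. Qed.

Lemma Re_sum (I : Type) (r : seq I) (P : pred I) (F : I -> C) :
  Re (\sum_(j <- r | P j) F j) = \sum_(j <- r | P j) Re (F j).
Proof. by apply: (big_morph Re cReD). Qed.

Lemma Im_sum (I : Type) (r : seq I) (P : pred I) (F : I -> C) :
  Im (\sum_(j <- r | P j) F j) = \sum_(j <- r | P j) Im (F j).
Proof. by apply: (big_morph Im cImD). Qed.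

Lemma Re_realM (x : R) z : Re (x%:C * z) = x * Re z.
Proof. by rewrite cReM /= mul0r subr0. Qed.

Lemma Im_realM (x : R) z : Im (x%:C * z) = x * Im z.
Proof. by rewrite cImM /= mul0r addr0. Qed.

Lemma sqr_normcE z : normc z ^+ 2 = Re z ^+ 2 + Im z ^+ 2.
Proof. by case: z => a b /=; rewrite sqr_sqrtr // addr_ge0 ?sqr_ge0. Qed.

Lemma normc_ge0 z : 0 <= normc z.
Proof. by case: z => a b; apply: sqrtr_ge0. Qed.

Lemma Re_le_normc z : `|Re z| <= normc z.
Proof.
rewrite -(ler_pXn2r (n := 2)) ?nnegrE ?normc_ge0 //.
by rewrite sqr_normcE real_normK ?num_real // lerDl sqr_ge0.
Qed.

Lemma Im_le_normc z : `|Im z| <= normc z.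
Proof.
rewrite -(ler_pXn2r (n := 2)) ?nnegrE ?normc_ge0 //.
by rewrite sqr_normcE real_normK ?num_real // lerDr sqr_ge0.
Qed.

Lemma normc_real (x : R) : normc x%:C = `|x|.
Proof. by rewrite /= expr0n addr0 sqrtr_sqr. Qed.

Lemma ler_normc_sum (I : Type) (r : seq I) (P : pred I) (F : I -> C) :
  normc (\sum_(j <- r | P j) F j) <= \sum_(j <- r | P j) normc (F j).
Proof.
elim/big_rec2: _ => [|j x y _ h]; first by rewrite ComplexField.Normc.normc0.
by apply: le_trans (le_normcD _ _) _; rewrite lerD2l.
Qed.

Section Dot.
Variable m : nat.
Implicit Types u v w : 'cV[C]_m.

Definition dot u v : C := (u^t* *m v) ord0 ord0.
Definition nsq v : R := Re (dot v v).
Definition nrm v : R := Num.sqrt (nsq v).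

Lemma dotE u v : dot u v = \sum_i (u i ord0)^*%C * v i ord0.
Proof. by rewrite /dot mxE; apply: eq_bigr => i _; rewrite !mxE. Qed.

Lemma dotDr u v w : dot u (v + w) = dot u v + dot u w.
Proof. by rewrite /dot mulmxDr mxE. Qed.

Lemma dotZr z u v : dot u (z *: v) = z * dot u v.
Proof. by rewrite /dot -scalemxAr mxE. Qed.

Lemma dotC u v : dot u v = (dot v u)^*%C.
Proof.
rewrite !dotE rmorph_sum; apply: eq_bigr => i _ /=.
by rewrite rmorphM /= conjcK mulrC.
Qed.

Lemma dotDl u v w : dot (u + v) w = dot u w + dot v w.
Proof. by rewrite dotC dotDr rmorphD /= -!dotC. Qed.

Lemma dotZl z u v : dot (z *: u) v = z^*%C * dot u v.
Proof. by rewrite dotC dotZr rmorphM /= -!dotC. Qed.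

Lemma nsqE v : nsq v = \sum_i normc (v i ord0) ^+ 2.
Proof.
rewrite /nsq dotE Re_sum; apply: eq_bigr => i _.
by rewrite sqr_normcE cReM; case: (v i ord0) => a b /=; ring.
Qed.

Lemma nsq_ge0 v : 0 <= nsq v.
Proof. by rewrite nsqE sumr_ge0 // => i _; rewrite sqr_ge0. Qed.

Lemma nrm_ge0 v : 0 <= nrm v. Proof. exact: sqrtr_ge0. Qed.

Lemma nrm_sqr v : nrm v ^+ 2 = nsq v.
Proof. by rewrite sqr_sqrtr ?nsq_ge0. Qed.

Lemma nrm0_eq0 v : nrm v = 0 -> v = 0.
Proof.
move=> h; have : nsq v = 0 by rewrite -nrm_sqr h expr0n.
rewrite nsqE => /eqP; rewrite psumr_eq0 => [|i _]; last by rewrite sqr_ge0.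
move=> /allP h2; apply/colP => i; rewrite mxE.
have := h2 i (mem_index_enum _); rewrite sqrf_eq0 => /eqP.
exact: ComplexField.Normc.eq0_normc.
Qed.

Lemma dotvv v : dot v v = (nsq v)%:C.
Proof.
rewrite /nsq; have : Im (dot v v) = 0; last by case: (dot v v) => a b /= ->.
by have := congr1 Im (dotC v v); case: (dot v v) => a b /=; lra.
Qed.

Lemma nsqD u v : nsq (u + v) = nsq u + nsq v + 2 * Re (dot u v).
Proof.
rewrite /nsq !dotDl !dotDr !cReD [dot v u]dotC.
by case: (dot u v) => a b /=; ring.
Qed.

Lemma nsqZ z v : nsq (z *: v) = normc z ^+ 2 * nsq v.
Proof.
rewrite !nsqE mulr_sumr; apply: eq_bigr => i _.
by rewrite mxE ComplexField.Normc.normcM exprMn.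
Qed.

Lemma nrmZ z v : nrm (z *: v) = normc z * nrm v.
Proof. by rewrite /nrm nsqZ sqrtrM ?sqr_ge0 // sqrtr_sqr ger0_norm ?normc_ge0. Qed.

Lemma CS_Re u v : Re (dot u v) <= nrm u * nrm v.
Proof.
have [/nrm0_eq0 ->|u0] := eqVneq (nrm u) 0.
  rewrite -[X in dot X _](scale0r 0) dotZl conjc0 mul0r /=.
  by rewrite mulr_ge0 ?nrm_ge0.
have [/nrm0_eq0 ->|v0] := eqVneq (nrm v) 0.
  rewrite -[X in dot _ X](scale0r 0) dotZr mul0r /=.
  by rewrite mulr_ge0 ?nrm_ge0.
have u1 : 0 < nrm u by rewrite lt_def u0 nrm_ge0.
have v1 : 0 < nrm v by rewrite lt_def v0 nrm_ge0.
(* Expanding the squared norm of |v| u - |u| v gives twice |u| |v| times the wanted difference. *)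
have := nsq_ge0 ((nrm v)%:C *: u + (- nrm u)%:C *: v).
rewrite nsqD !nsqZ dotZl dotZr conjc_real !Re_realM !normc_real normrN.
rewrite !ger0_norm ?nrm_ge0 // -!nrm_sqr => h.
have h1 : 0 <= nrm u * nrm v * (nrm u * nrm v - Re (dot u v)) by lra.
by rewrite pmulr_rge0 ?mulr_gt0 // subr_ge0 in h1.
Qed.

Lemma normc_sqrE z : z^*%C * z = (normc z ^+ 2)%:C.
Proof. by rewrite sqr_normcE; case: z => a b; simpc; congr Complex; ring. Qed.

(** Multiplying [u] by z = <u, v> makes the inner product equal to the real number |z|^2, which
    reduces the claim to [CS_Re]. *)
Lemma CS u v : normc (dot u v) <= nrm u * nrm v.
Proof.
set z := dot u v.
have [->|z0] := eqVneq (normc z) 0; first by rewrite mulr_ge0 ?nrm_ge0.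
have z1 : 0 < normc z by rewrite lt_def z0 normc_ge0.
have := CS_Re (z *: u) v.
rewrite dotZl -/z normc_sqrE nrmZ /= expr2 -mulrA ler_pM2l //.
Qed.

Lemma nrmD u v : nrm (u + v) <= nrm u + nrm v.
Proof.
rewrite -(ler_pXn2r (n := 2)) ?nnegrE ?addr_ge0 ?nrm_ge0 //.
by rewrite nrm_sqr nsqD -!nrm_sqr; have := CS_Re u v; lra.
Qed.

Lemma nrm0 : nrm 0 = 0.
Proof. by rewrite -(scale0r 0) nrmZ ComplexField.Normc.normc0 mul0r. Qed.

Lemma nrmN v : nrm (- v) = nrm v.
Proof. by rewrite -scaleN1r nrmZ normcN ComplexField.Normc.normc1 mul1r. Qed.

End Dot.

Lemma trC_mul (m n p : nat) (X : 'M[C]_(m, n)) (Y : 'M[C]_(n, p)) :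
  (X *m Y)^t* = Y^t* *m X^t*.
Proof. by rewrite trmx_mul map_mxM. Qed.

Lemma dot_adj (m n : nat) (X : 'M[C]_(m, n)) u v :
  dot u (X *m v) = dot (X^t* *m u) v.
Proof. by rewrite /dot trC_mul trmxCK mulmxA. Qed.

End Vectors.

(** * Derivatives of matrix-valued functions *)

Section MatrixDerivative.
Variable R : realType.
Local Notation C := R[i].
Local Notation Re := (@complex.Re R).
Local Notation Im := (@complex.Im R).

(** Entrywise, in real and imaginary parts, to match the definition of [mexp]: only real calculus in
    one variable is then needed. *)
Definition mderiv (m n : nat) (F : R -> 'M[C]_(m, n)) (s : R) (F' : 'M[C]_(m, n)) :=
  forall i j, is_derive s (1 : R) (fun x => Re (F x i j)) (Re (F' i j)) /\
              is_derive s (1 : R) (fun x => Im (F x i j)) (Im (F' i j)).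

Lemma is_derive_add (f g : R -> R) s f' g' :
  is_derive s (1 : R) f f' -> is_derive s (1 : R) g g' ->
  is_derive s (1 : R) (fun x => f x + g x) (f' + g').
Proof. by move=> hf hg; exact: is_deriveD. Qed.

Lemma is_derive_mul (f g : R -> R) s f' g' :
  is_derive s (1 : R) f f' -> is_derive s (1 : R) g g' ->
  is_derive s (1 : R) (fun x => f x * g x) (f' * g s + f s * g').
Proof.
move=> hf hg; have := is_deriveM hf hg.
by move/is_derive_eq; apply; rewrite addrC mulrC.
Qed.

Lemma is_derive_opp (f : R -> R) s f' :
  is_derive s (1 : R) f f' -> is_derive s (1 : R) (fun x => - f x) (- f').
Proof. by move=> hf; exact: is_deriveN. Qed.

Lemma is_derive_fsum (I : Type) (r : seq I) (F : I -> R -> R) F' s :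
  (forall j, is_derive s (1 : R) (F j) (F' j)) ->
  is_derive s (1 : R) (fun x => \sum_(j <- r) F j x) (\sum_(j <- r) F' j).
Proof.
move=> h; elim: r => [|j r ih].
  rewrite big_nil (_ : (fun _ => _) = cst 0); last first.
    by apply/funext => x; rewrite big_nil.
  exact: is_derive_cst.
rewrite big_cons (_ : (fun _ => _) = fun x => F j x + \sum_(j <- r) F j x).
  exact: is_derive_add.
by apply/funext => x; rewrite big_cons.
Qed.

Lemma mderiv_cst m n (A : 'M[C]_(m, n)) s : mderiv (fun=> A) s 0.
Proof.
by move=> i j; rewrite mxE; split; exact: is_derive_cst.
Qed.

Lemma mderivD m n (F G : R -> 'M[C]_(m, n)) s F' G' :
  mderiv F s F' -> mderiv G s G' -> mderiv (fun x => F x + G x) s (F' + G').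
Proof.
move=> hF hG i j; rewrite mxE cReD cImD.
under eq_fun do rewrite mxE cReD; under [X in _ /\ is_derive _ _ X _]eq_fun do rewrite mxE cImD.
by split; apply: is_derive_add; case: (hF i j); case: (hG i j).
Qed.

Lemma mderiv_mul m n p (F : R -> 'M[C]_(m, n)) (G : R -> 'M[C]_(n, p)) s F' G' :
  mderiv F s F' -> mderiv G s G' ->
  mderiv (fun x => F x *m G x) s (F' *m G s + F s *m G').
Proof.
move=> hF hG i j; rewrite !mxE -big_split /= Re_sum Im_sum.
under eq_fun do rewrite mxE Re_sum.
under [X in _ /\ is_derive _ _ X _]eq_fun do rewrite mxE Im_sum.
split; apply: is_derive_fsum => k; have [hf1 hf2] := hF i k; have [hg1 hg2] := hG k j.
  under eq_fun do rewrite cReM.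
  have := is_derive_add (is_derive_mul hf1 hg1) (is_derive_opp (is_derive_mul hf2 hg2)).
  by move/is_derive_eq; apply; rewrite cReD !cReM; ring.
under eq_fun do rewrite cImM.
have := is_derive_add (is_derive_mul hf1 hg2) (is_derive_mul hf2 hg1).
by move/is_derive_eq; apply; rewrite cImD !cImM; ring.
Qed.

Lemma mderivMl m n p (A : 'M[C]_(m, n)) (G : R -> 'M[C]_(n, p)) s G' :
  mderiv G s G' -> mderiv (fun x => A *m G x) s (A *m G').
Proof.
by move=> h; have := mderiv_mul (mderiv_cst A s) h; rewrite mul0mx add0r.
Qed.

Lemma mderivMr m n p (F : R -> 'M[C]_(m, n)) (A : 'M[C]_(n, p)) s F' :
  mderiv F s F' -> mderiv (fun x => F x *m A) s (F' *m A).
Proof.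
by move=> h; have := mderiv_mul h (mderiv_cst A s); rewrite mulmx0 addr0.
Qed.

Lemma mderivN m n (F : R -> 'M[C]_(m, n)) s F' :
  mderiv F s F' -> mderiv (fun x => - F x) s (- F').
Proof.
have reN (z : C) : Re (- z) = - Re z by case: z.
have imN (z : C) : Im (- z) = - Im z by case: z.
move=> h i j; rewrite mxE reN imN.
under eq_fun do rewrite mxE reN.
under [X in _ /\ is_derive _ _ X _]eq_fun do rewrite mxE imN.
by split; apply: is_derive_opp; case: (h i j).
Qed.

Lemma mderivB m n (F G : R -> 'M[C]_(m, n)) s F' G' :
  mderiv F s F' -> mderiv G s G' -> mderiv (fun x => F x - G x) s (F' - G').
Proof. by move=> hF hG; apply: mderivD => //; apply: mderivN. Qed.

Lemma mderivZ m n (f : R -> R) (A : 'M[C]_(m, n)) s f' :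
  is_derive s (1 : R) f f' -> mderiv (fun x => (f x)%:C *: A) s (f'%:C *: A).
Proof.
move=> h i j; rewrite mxE Re_realM Im_realM.
under eq_fun do rewrite mxE Re_realM.
under [X in _ /\ is_derive _ _ X _]eq_fun do rewrite mxE Im_realM.
split; [have := is_derive_mul h (is_derive_cst (Re (A i j)) s 1) |
        have := is_derive_mul h (is_derive_cst (Im (A i j)) s 1)];
  by move/is_derive_eq; apply; rewrite mulr0 addr0.
Qed.

Lemma mderiv_sum m n (I : Type) (r : seq I) (F : I -> R -> 'M[C]_(m, n)) F' s :
  (forall j, mderiv (F j) s (F' j)) ->
  mderiv (fun x => \sum_(j <- r) F j x) s (\sum_(j <- r) F' j).
Proof.
move=> h; elim: r => [|j r ih].
  rewrite big_nil (_ : (fun _ => _) = cst 0); last first.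
    by apply/funext => x; rewrite big_nil.
  exact: mderiv_cst.
rewrite big_cons (_ : (fun _ => _) = fun x => F j x + \sum_(j <- r) F j x).
  exact: mderivD.
by apply/funext => x; rewrite big_cons.
Qed.

Lemma mderiv_scale m n (F : R -> 'M[C]_(m, n)) (c s : R) F' :
  mderiv F (c * s) F' -> mderiv (fun x => F (c * x)) s (c%:C *: F').
Proof.
move=> h i j; have [h1 h2] := h i j; rewrite mxE Re_realM Im_realM.
have hc : is_derive s (1 : R) ( *%R c) c.
  have := is_derive_mul (is_derive_cst c s 1) (is_derive_id s 1).
  by move/is_derive_eq; apply; rewrite mul0r add0r mulr1.
by split; [have := is_derive1_comp h1 hc | have := is_derive1_comp h2 hc];
  move/is_derive_eq; apply; rewrite mulrC.
Qed.

Lemma mderiv_eq m n (F : R -> 'M[C]_(m, n)) s A B : mderiv F s A -> A = B -> mderiv F s B.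
Proof. by move=> ? <-. Qed.

Lemma mderiv0_cst m n (F : R -> 'M[C]_(m, n)) s :
  (forall x, mderiv F x 0) -> F s = F 0.
Proof.
move=> h; apply/matrixP => i j.
have h1 : Re (F s i j) = Re (F 0 i j).
  apply: (is_derive_0_is_cst (f := fun x => Re (F x i j))) => x.
  by have [] := h x i j; rewrite mxE.
have h2 : Im (F s i j) = Im (F 0 i j).
  apply: (is_derive_0_is_cst (f := fun x => Im (F x i j))) => x.
  by have [] := h x i j; rewrite mxE.
by case: (F s i j) (F 0 i j) h1 h2 => a b [c d] /= -> ->.
Qed.

(** Pairing with fixed vectors turns an operator estimate into one for a real function, to which the
    mean value theorem applies. *)
Lemma mderiv_Re_dot m n (F : R -> 'M[C]_(m, n)) s F' (u : 'cV[C]_m) (v : 'cV[C]_n) :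
  mderiv F s F' ->
  is_derive s (1 : R) (fun x => Re (dot u (F x *m v))) (Re (dot u (F' *m v))).
Proof. by move=> h; have [] := mderivMl (u^t*) (mderivMr v h) ord0 ord0. Qed.

End MatrixDerivative.

(** * The matrix exponential *)

Section Exponential.
Variable R : realType.
Local Notation C := R[i].
Local Notation Re := (@complex.Re R).
Local Notation Im := (@complex.Im R).

(* [egf g] is the exponential generating function \sum_k g_k x^k / k! *)
Definition egf_terms (g : nat -> R) (k : nat) : R := g k / k`!%:R.
Definition egf (g : nat -> R) (x : R) : R := limn (pseries (egf_terms g) x).
Definition egf_cvg (g : nat -> R) := forall x, cvgn (pseries (egf_terms g) x).

Lemma egf_cvg_bounded (g : nat -> R) (M b : R) : 0 <= b ->
  (forall k, `|g k| <= M * b ^+ k) -> egf_cvg g.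
Proof.
move=> b0 h x; have M0 : 0 <= M.
  by have := h 0%N; rewrite expr0 mulr1; apply: le_trans.
apply: normed_cvg.
apply: (@series_le_cvg _ _ (fun k => M * exp_coeff (b * `|x|) k)) => //.
- by move=> k; exact: normr_ge0.
- by move=> k; apply: mulr_ge0 => //; apply: exp_coeff_ge0; rewrite mulr_ge0.
- move=> k /=; rewrite /egf_terms /exp_coeff /= !normrM normfV normrX.
  rewrite (ger0_norm (ler0n _ _)) exprMn mulrAC mulrA mulrA.
  by rewrite ler_pM2r ?invr_gt0 ?ltr0n ?fact_gt0 // ler_wpM2r ?exprn_ge0.
by apply: is_cvg_seriesZ; exact: is_cvg_series_exp_coeff.
Qed.

(** Differentiating an exponential generating function shifts its coefficients. Termwise
    differentiation at [x] uses convergence of the series and its first two derivatives at a point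
    of larger modulus. *)
Lemma egf_derive (g : nat -> R) (x : R) :
  egf_cvg g -> egf_cvg (fun k => g k.+1) -> egf_cvg (fun k => g k.+2) ->
  is_derive x (1 : R) (egf g) (egf (fun k => g k.+1) x).
Proof.
have sh (h : nat -> R) : pseries_diffs (egf_terms h) = egf_terms (fun k => h k.+1).
  apply/funext => k; rewrite /pseries_diffs /egf_terms factS natrM invfM.
  by rewrite mulrCA mulVKf // pnatr_eq0.
move=> h0 h1 h2; rewrite /egf -sh.
apply: (@pseries_snd_diffs _ _ (`|x| + 1)); rewrite ?sh //.
by rewrite [ltRHS]ger0_norm ?addr_ge0 // ltrDl.
Qed.

Lemma egfD (g h : nat -> R) : egf_cvg g -> egf_cvg h ->
  egf_cvg (fun k => g k + h k) /\
  forall x, egf (fun k => g k + h k) x = egf g x + egf h x.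
Proof.
move=> hg hh.
have E x : pseries (egf_terms (fun k => g k + h k)) x =
           pseries (egf_terms g) x \+ pseries (egf_terms h) x.
  apply/funext => n; rewrite /pseries /series /= -big_split /=.
  by apply: eq_bigr => k _; rewrite /egf_terms !mulrDl.
by split=> x; rewrite /egf E; [apply: is_cvgD | apply: limD].
Qed.

Lemma egfZ (c : R) (g : nat -> R) : egf_cvg g ->
  egf_cvg (fun k => c * g k) /\ forall x, egf (fun k => c * g k) x = c * egf g x.
Proof.
move=> hg.
have E x : pseries (egf_terms (fun k => c * g k)) x =
           (fun n => c * pseries (egf_terms g) x n).
  apply/funext => n; rewrite /pseries /series /= mulr_sumr.
  by apply: eq_bigr => k _; rewrite /egf_terms !mulrA.
by split=> x; rewrite /egf E; [exact: is_cvgZl_tmp | exact: limZl_tmp].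
Qed.

Lemma egf_sum (I : Type) (r : seq I) (g : I -> nat -> R) :
  (forall j, egf_cvg (g j)) ->
  egf_cvg (fun k => \sum_(j <- r) g j k) /\
  forall x, egf (fun k => \sum_(j <- r) g j k) x = \sum_(j <- r) egf (g j) x.
Proof.
move=> hg; elim: r => [|j r [ih1 ih2]].
  have -> : (fun k : nat => \sum_(j <- [::]) g j k) = (fun k => 0 * 0).
    by apply/funext => k; rewrite big_nil mul0r.
  have h0 : egf_cvg (fun=> 0).
    by apply: (@egf_cvg_bounded _ 0 0) => // k; rewrite normr0 mul0r.
  have [h1 h2] := egfZ 0 h0.
  by split=> // x; rewrite h2 mul0r big_nil.
have -> : (fun k : nat => \sum_(i <- j :: r) g i k) =
          (fun k => g j k + \sum_(i <- r) g i k).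
  by apply/funext => k; rewrite big_cons.
have [h1 h2] := egfD (hg j) ih1.
by split=> // x; rewrite h2 big_cons ih2.
Qed.

Variable n : nat.
Local Notation A := 'M[C]_n.+1.
Implicit Types X Y : A.

Definition mexpt X (t : R) : A := mexp (t%:C *: X).

(** A crude norm whose powers dominate the entries of the powers of [X]. It serves convergence only
    and does not enter the error constant. *)
Definition entry_sum X : R := \sum_i \sum_j normc (X i j).

Lemma entry_sum_ge0 X : 0 <= entry_sum X.
Proof. by rewrite sumr_ge0 // => i _; rewrite sumr_ge0 // => j _; rewrite normc_ge0. Qed.

Lemma normc_exp_le X k i j : normc ((X ^+ k) i j) <= entry_sum X ^+ k.
Proof.
elim: k i j => [|k ih] i j.
  rewrite !expr0 mxE; case: (_ == _) => /=.
    by rewrite expr0n addr0 expr1n sqrtr1.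
  by rewrite !expr0n /= addr0 sqrtr0.
rewrite exprS mxE; apply: le_trans (ler_normc_sum _ _ _) _.
rewrite exprS; apply: (@le_trans _ _ (\sum_l normc (X i l) * entry_sum X ^+ k)).
  apply: ler_sum => l _.
  by rewrite ComplexField.Normc.normcM ler_wpM2l ?normc_ge0.
rewrite -mulr_suml ler_wpM2r ?exprn_ge0 ?entry_sum_ge0 //.
rewrite /entry_sum [leRHS](bigD1 i) //= lerDl.
by rewrite sumr_ge0 // => l _; rewrite sumr_ge0 // => ? _; rewrite normc_ge0.
Qed.

Lemma egf_cvg_Re X d i j : egf_cvg (fun k => Re ((X ^+ (k + d)%N) i j)).
Proof.
apply: (@egf_cvg_bounded _ (entry_sum X ^+ d) (entry_sum X)) => [|k].
  exact: entry_sum_ge0.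
by rewrite -exprD addnC; apply: le_trans (Re_le_normc _) (normc_exp_le _ _ _ _).
Qed.

Lemma egf_cvg_Im X d i j : egf_cvg (fun k => Im ((X ^+ (k + d)%N) i j)).
Proof.
apply: (@egf_cvg_bounded _ (entry_sum X ^+ d) (entry_sum X)) => [|k].
  exact: entry_sum_ge0.
by rewrite -exprD addnC; apply: le_trans (Im_le_normc _) (normc_exp_le _ _ _ _).
Qed.

Lemma mexpt_partial X t i j (m : nat) :
  (\sum_(k < m) (k`!%:R)^-1 *: (t%:C *: X) ^+ k) i j =
  \sum_(k < m) ((k`!%:R)^-1 * t ^+ k)%:C * (X ^+ k) i j.
Proof.
rewrite summxE; apply: eq_bigr => k _.
by rewrite exprZn scalerA mxE rmorphM fmorphV rmorph_nat rmorphXn.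
Qed.

Lemma Re_mexpt X t i j : Re (mexpt X t i j) = egf (fun k => Re ((X ^+ k) i j)) t.
Proof.
rewrite mxE /= /egf; congr (limn _); apply/funext => m.
rewrite mexpt_partial Re_sum /pseries /series /= big_mkord.
by apply: eq_bigr => k _; rewrite Re_realM /egf_terms mulrC mulrA.
Qed.

Lemma Im_mexpt X t i j : Im (mexpt X t i j) = egf (fun k => Im ((X ^+ k) i j)) t.
Proof.
rewrite mxE /= /egf; congr (limn _); apply/funext => m.
rewrite mexpt_partial Im_sum /pseries /series /= big_mkord.
by apply: eq_bigr => k _; rewrite Im_realM /egf_terms mulrC mulrA.
Qed.

Let cvRe X i j : egf_cvg (fun k => Re ((X ^+ k) i j)).
Proof. by have := @egf_cvg_Re X 0 i j; under eq_fun do rewrite addn0. Qed.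

Let cvIm X i j : egf_cvg (fun k => Im ((X ^+ k) i j)).
Proof. by have := @egf_cvg_Im X 0 i j; under eq_fun do rewrite addn0. Qed.

Let egf_bilinear (a b : 'I_n.+1 -> R) (g h : 'I_n.+1 -> nat -> R) t :
  (forall l, egf_cvg (g l)) -> (forall l, egf_cvg (h l)) ->
  egf (fun k => \sum_l (a l * g l k + b l * h l k)) t =
  \sum_l (a l * egf (g l) t + b l * egf (h l) t).
Proof.
move=> hg hh.
have hD l := egfD (proj1 (egfZ (a l) (hg l))) (proj1 (egfZ (b l) (hh l))).
rewrite (proj2 (egf_sum _ (fun l => proj1 (hD l)))); apply: eq_bigr => l _.
by rewrite (proj2 (hD l)) (proj2 (egfZ _ (hg l))) (proj2 (egfZ _ (hh l))).
Qed.

(** An entry of a product with a fixed matrix is a finite linear combination of entries, so the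
    product passes inside the series. With the three variants that follow, identities for [mexpt]
    can be checked on the powers of [X]. *)
Lemma Re_mul_mexpt Y X t i j :
  Re ((Y * mexpt X t) i j) = egf (fun k => Re ((Y * X ^+ k) i j)) t.
Proof.
transitivity (egf (fun k => \sum_l (Re (Y i l) * Re ((X ^+ k) l j) +
                                    (- Im (Y i l)) * Im ((X ^+ k) l j))) t).
  rewrite (egf_bilinear (fun l => Re (Y i l)) (fun l => - Im (Y i l))) //.
  rewrite mxE Re_sum; apply: eq_bigr => l _.
  by rewrite cReM Re_mexpt Im_mexpt mulNr.
congr (egf _ t); apply/funext => k; rewrite mxE Re_sum; apply: eq_bigr => l _.
by rewrite cReM mulNr.
Qed.

Lemma Im_mul_mexpt Y X t i j :
  Im ((Y * mexpt X t) i j) = egf (fun k => Im ((Y * X ^+ k) i j)) t.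
Proof.
transitivity (egf (fun k => \sum_l (Re (Y i l) * Im ((X ^+ k) l j) +
                                    (Im (Y i l)) * Re ((X ^+ k) l j))) t).
  rewrite (egf_bilinear (fun l => Re (Y i l)) (fun l => Im (Y i l))) //.
  rewrite mxE Im_sum; apply: eq_bigr => l _.
  by rewrite cImM Re_mexpt Im_mexpt.
congr (egf _ t); apply/funext => k; rewrite mxE Im_sum; apply: eq_bigr => l _.
by rewrite cImM.
Qed.

Lemma Re_mexpt_mul Y X t i j :
  Re ((mexpt X t * Y) i j) = egf (fun k => Re ((X ^+ k * Y) i j)) t.
Proof.
transitivity (egf (fun k => \sum_l (Re (Y l j) * Re ((X ^+ k) i l) +
                                    (- Im (Y l j)) * Im ((X ^+ k) i l))) t).
  rewrite (egf_bilinear (fun l => Re (Y l j)) (fun l => - Im (Y l j))) //.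
  rewrite mxE Re_sum; apply: eq_bigr => l _.
  by rewrite mulrC cReM Re_mexpt Im_mexpt mulNr.
congr (egf _ t); apply/funext => k; rewrite mxE Re_sum; apply: eq_bigr => l _.
by rewrite [in RHS]mulrC cReM mulNr.
Qed.

Lemma Im_mexpt_mul Y X t i j :
  Im ((mexpt X t * Y) i j) = egf (fun k => Im ((X ^+ k * Y) i j)) t.
Proof.
transitivity (egf (fun k => \sum_l (Re (Y l j) * Im ((X ^+ k) i l) +
                                    (Im (Y l j)) * Re ((X ^+ k) i l))) t).
  rewrite (egf_bilinear (fun l => Re (Y l j)) (fun l => Im (Y l j))) //.
  rewrite mxE Im_sum; apply: eq_bigr => l _.
  by rewrite mulrC cImM Re_mexpt Im_mexpt.
congr (egf _ t); apply/funext => k; rewrite mxE Im_sum; apply: eq_bigr => l _.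
by rewrite [in RHS]mulrC cImM.
Qed.

Lemma complex_eq (z w : C) : Re z = Re w -> Im z = Im w -> z = w.
Proof. by case: z w => a b [c d] /= -> ->. Qed.

Lemma mexpt_comm Y X t : GRing.comm Y X -> GRing.comm Y (mexpt X t).
Proof.
move=> h; apply/matrixP => i j; apply: complex_eq.
  rewrite Re_mul_mexpt Re_mexpt_mul; congr (egf _ _); apply/funext => k.
  by rewrite (commrX k h).
rewrite Im_mul_mexpt Im_mexpt_mul; congr (egf _ _); apply/funext => k.
by rewrite (commrX k h).
Qed.

Lemma mderiv_mexpt X t : mderiv (mexpt X) t (X * mexpt X t).
Proof.
move=> i j; rewrite Re_mul_mexpt Im_mul_mexpt.
rewrite (_ : (fun x => Re (mexpt X x i j)) = egf (fun k => Re ((X ^+ k) i j))); last first.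
  by apply/funext => x; rewrite Re_mexpt.
rewrite (_ : (fun x => Im (mexpt X x i j)) = egf (fun k => Im ((X ^+ k) i j))); last first.
  by apply/funext => x; rewrite Im_mexpt.
rewrite (_ : (fun k => Re ((X * X ^+ k) i j)) = (fun k => Re ((X ^+ k.+1) i j))); last first.
  by apply/funext => k; rewrite exprS.
rewrite (_ : (fun k => Im ((X * X ^+ k) i j)) = (fun k => Im ((X ^+ k.+1) i j))); last first.
  by apply/funext => k; rewrite exprS.
split; apply: egf_derive => //.
- by have := @egf_cvg_Re X 1 i j; under eq_fun do rewrite addn1.
- by have := @egf_cvg_Re X 2 i j; under eq_fun do rewrite addn2.
- by have := @egf_cvg_Im X 1 i j; under eq_fun do rewrite addn1.
- by have := @egf_cvg_Im X 2 i j; under eq_fun do rewrite addn2.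
Qed.

Lemma egf0 (g : nat -> R) : egf g 0 = g 0%N.
Proof.
rewrite /egf; apply: cvg_lim => //; apply/cvg_ballP => e e0.
near=> m; rewrite /pseries /series /=.
have m0 : (0 < m)%N by near: m; exact: nbhs_infty_gt.
rewrite -(prednK m0) big_nat_recl //= expr0 mulr1 big1 ?addr0.
  by rewrite /egf_terms fact0 divr1; exact: ballxx.
by move=> k _; rewrite expr0n mulr0.
Unshelve. all: by end_near. Qed.

Lemma mexpt0 X : mexpt X 0 = 1.
Proof.
by apply/matrixP => i j; apply: complex_eq; rewrite ?Re_mexpt ?Im_mexpt egf0 expr0.
Qed.

Lemma mderiv_mexptN X t : mderiv (fun x => mexpt X (- x)) t (- (X * mexpt X (- t))).
Proof.
have -> : (fun x => mexpt X (- x)) = (fun x => mexpt X (-1 * x)).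
  by apply/funext => x; rewrite mulN1r.
apply: mderiv_eq (mderiv_scale (mderiv_mexpt X (-1 * t))) _.
by rewrite mulN1r (rmorphN1 (real_complex R)) scaleN1r.
Qed.

(** The product has derivative zero, so it equals its value at 0; no Cauchy product of series is
    involved. *)
Lemma mexptVr X t : mexpt X t * mexpt X (- t) = 1.
Proof.
have -> : mexpt X t * mexpt X (- t) = (fun x => mexpt X x *m mexpt X (- x)) t by [].
rewrite (@mderiv0_cst _ _ _ (fun x => mexpt X x *m mexpt X (- x))).
  by rewrite oppr0 mexpt0 mulmx1.
move=> x; apply: mderiv_eq (mderiv_mul (mderiv_mexpt _ _) (mderiv_mexptN _ _)) _.
rewrite -![_ *m _]/(_ * _) mulrN mulrA [X * mexpt X x](@mexpt_comm X X x) //.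
by rewrite subrr.
Qed.

Lemma mexptVl X t : mexpt X (- t) * mexpt X t = 1.
Proof. by have := mexptVr X (- t); rewrite opprK. Qed.

End Exponential.

(** * Bounds on a particle-number sector *)

Section SectorBounds.
Variables (R : realType) (n : nat).
Local Notation C := R[i].
Local Notation Re := (@complex.Re R).
Local Notation Im := (@complex.Im R).
Local Notation A := 'M[C]_n.+1.
Variables (Nop : A) (eta : C).
Implicit Types (X Y Z : A) (v : 'cV[C]_n.+1).

Definition insec v := Nop *m v = eta *: v.

(** Commutation with [Nop] is part of the bound: it keeps the sector invariant, and this is what
    lets bounds multiply. *)
Definition opb X (c : R) :=
  GRing.comm Nop X /\ forall v, insec v -> nrm (X *m v) <= c * nrm v.

Lemma insec_mul X v : GRing.comm Nop X -> insec v -> insec (X *m v).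
Proof.
move=> h hv; rewrite /insec mulmxA -[Nop *m X]/(Nop * X) h.
by rewrite -[X * Nop]/(X *m Nop) -mulmxA hv scalemxAr.
Qed.

Lemma opb_le X c c' : c <= c' -> opb X c -> opb X c'.
Proof.
move=> hc [h1 h2]; split=> // v hv; apply: le_trans (h2 v hv) _.
by rewrite ler_wpM2r ?nrm_ge0.
Qed.

Lemma opbD X Y c d : opb X c -> opb Y d -> opb (X + Y) (c + d).
Proof.
move=> [h1 h2] [h3 h4]; split; first exact: commrD.
move=> v hv; rewrite mulmxDl mulrDl; apply: le_trans (nrmD _ _) _.
by apply: lerD; [exact: h2 | exact: h4].
Qed.

Lemma commrZ X z Y : GRing.comm X Y -> GRing.comm X (z *: Y).
Proof. by move=> h; rewrite /GRing.comm -scalerAr h scalerAl. Qed.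

Lemma opbZ z X c : opb X c -> opb (z *: X) (normc z * c).
Proof.
move=> [h1 h2]; split; first exact: commrZ.
by move=> v hv; rewrite -scalemxAl nrmZ -mulrA ler_wpM2l ?normc_ge0 ?h2.
Qed.

Lemma opbM X Y c d : 0 <= c -> opb X c -> opb Y d -> opb (X * Y) (c * d).
Proof.
move=> hc [h1 h2] [h3 h4]; split; first exact: commrM.
move=> v hv; rewrite -mulmxA; apply: le_trans (h2 _ (insec_mul h3 hv)) _.
by rewrite -mulrA ler_wpM2l ?h4.
Qed.

Lemma opb0 : opb 0 0.
Proof. by split; [exact: commr0 | move=> v _; rewrite mul0mx nrm0 mul0r]. Qed.

Lemma opb1 : opb 1 1.
Proof. by split; [exact: commr1 | move=> v _; rewrite mul1mx mul1r]. Qed.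

Lemma opb_sum_nat (N : nat) (F : nat -> A) (c : nat -> R) :
  (forall j, (j < N)%N -> opb (F j) (c j)) ->
  opb (\sum_(0 <= j < N) F j) (\sum_(0 <= j < N) c j).
Proof.
elim: N => [|N ih] h; first by rewrite !big_geq //; exact: opb0.
rewrite !big_nat_recr //=; apply: opbD; last exact: h.
by apply: ih => j hj; apply: h; apply: leqW.
Qed.

Lemma is_derive_le (f f' : R -> R) (t M : R) : 0 <= t ->
  (forall s, is_derive s (1 : R) f (f' s)) ->
  (forall s, 0 <= s <= t -> f' s <= M) -> f t - f 0 <= M * t.
Proof.
move=> t0 hf hM.
have [|c] := @MVT_segment R f f' 0 t t0 (fun s _ => hf s).
  apply: derivable_within_continuous => s _.
  by have [] := hf s.
by rewrite in_itv /= => hc ->; rewrite subr0 ler_wpM2r ?hM.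
Qed.

(** The function is tested against the fixed vector w = F(t) v, for which Re <w, F(t) v> = |w|^2.
    The derivative is bounded by its value at the end point, giving up the factor 1/(q+1) of an
    integral. *)
Lemma opb_mean (F F' : R -> A) (T c : R) (q : nat) : 0 <= c ->
  (forall s, mderiv F s (F' s)) -> F 0 = 0 -> (forall s, GRing.comm Nop (F s)) ->
  (forall s, 0 <= s <= T -> opb (F' s) (c * s ^+ q)) ->
  forall t, 0 <= t <= T -> opb (F t) (c * t ^+ q.+1).
Proof.
move=> c0 hF F0 hN hB t /andP[t0 tT]; split=> // v hv.
set w := F t *m v.
have [->|w0] := eqVneq (nrm w) 0.
  by rewrite !mulr_ge0 ?exprn_ge0 ?nrm_ge0.
have w1 : 0 < nrm w by rewrite lt_def w0 nrm_ge0.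
have := @is_derive_le (fun s => Re (dot w (F s *m v))) (fun s => Re (dot w (F' s *m v)))
  t (nrm w * (c * t ^+ q * nrm v)) t0 (fun s => mderiv_Re_dot _ _ (hF s)).
rewrite F0 mul0mx -[X in _ - Re (dot _ X)](scale0r 0) dotZr mul0r subr0.
rewrite -/w dotvv -nrm_sqr /= expr2 => h; rewrite -(ler_pM2l w1).
have -> : nrm w * (c * t ^+ q.+1 * nrm v) = nrm w * (c * t ^+ q * nrm v) * t.
  by rewrite exprSr; ring.
apply: h => s /andP[s0 st].
apply: le_trans (CS_Re _ _) _; rewrite ler_wpM2l ?nrm_ge0 //.
have hsT : 0 <= s <= T by rewrite s0 (le_trans st tT).
have [_ /(_ v hv) hs] := hB s hsT; apply: le_trans hs _.
by rewrite ler_wpM2r ?nrm_ge0 // ler_wpM2l // lerXn2r ?nnegrE.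
Qed.

Lemma is_derive_nsq (W : R -> 'cV[C]_n.+1) s W' :
  mderiv W s W' -> is_derive s (1 : R) (fun x => nsq (W x)) (2 * Re (dot (W s) W')).
Proof.
move=> h; have -> : (fun x => nsq (W x)) = (fun x => \sum_i
    (Re (W x i ord0) * Re (W x i ord0) + Im (W x i ord0) * Im (W x i ord0))).
  by apply/funext => x; rewrite nsqE; apply: eq_bigr => i _; rewrite sqr_normcE !expr2.
rewrite dotE Re_sum mulr_sumr; apply: is_derive_fsum => i.
have [h1 h2] := h i ord0.
have := is_derive_add (is_derive_mul h1 h1) (is_derive_mul h2 h2).
move/is_derive_eq; apply; rewrite cReM.
by case: (W s i ord0) => a b; case: (W' i ord0) => c d /=; ring.
Qed.

(** Gronwall's argument: |e^(sX) v|^2 e^(-2bs) is nonincreasing. Only the Hermitian part of [X]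
    enters the hypothesis, so a skew-Hermitian [X] gives the bound 1 whatever its norm. *)
Lemma opb_mexpt X (b t : R) : 0 <= t -> GRing.comm Nop X ->
  (forall v, insec v -> Re (dot v (X *m v)) <= b * nsq v) ->
  opb (mexpt X t) (expR (b * t)).
Proof.
move=> t0 hN hb; have hE s : GRing.comm Nop (mexpt X s) by exact: mexpt_comm.
split=> // v hv.
pose W s := mexpt X s *m v.
have hW s : mderiv W s (X *m W s).
  by rewrite mulmxA; apply: mderivMr; apply: mderiv_mexpt.
pose g s := nsq (W s) * expR (- (2 * b) * s).
have he s : is_derive s (1 : R) (fun s => expR (- (2 * b) * s))
    (- (2 * b) * expR (- (2 * b) * s)).
  have h1 : is_derive s (1 : R) ( *%R (- (2 * b))) (- (2 * b)).
    have := is_derive_mul (is_derive_cst (- (2 * b)) s 1) (is_derive_id s 1).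
    by move/is_derive_eq; apply; rewrite mul0r add0r mulr1.
  have := is_derive1_comp (is_derive_expR (- (2 * b) * s)) h1.
  by move/is_derive_eq; apply; rewrite mulrC.
have hg s : is_derive s (1 : R) g (2 * (Re (dot (W s) (X *m W s)) - b * nsq (W s)) *
    expR (- (2 * b) * s)).
  have := is_derive_mul (is_derive_nsq (hW s)) (he s).
  by move/is_derive_eq; apply; ring.
have := @is_derive_le g _ t 0 t0 hg; rewrite mul0r subr_le0 => h.
have {h} : g t <= g 0.
  apply: h => s _; rewrite pmulr_lle0 ?expR_gt0 // pmulr_rle0 // subr_le0.
  exact/hb/insec_mul.
have -> : g 0 = nsq v by rewrite /g mulr0 expR0 mulr1 /W (mexpt0 X) mul1mx.
rewrite /g mulNr expRN ler_pdivrMr ?expR_gt0 //.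
rewrite -mulrA expRM_natl -!nrm_sqr mulrC -exprMn /W.
by rewrite ler_pXn2r // nnegrE ?nrm_ge0 // mulr_ge0 ?nrm_ge0 ?expR_ge0.
Qed.

Lemma mexpt_oppt X t : mexpt X (- t) = mexpt (- X) t.
Proof. by rewrite /mexpt rmorphN scaleNr scalerN. Qed.

Lemma opb_mexpt_abs X (b t T : R) : 0 <= b -> `|t| <= T -> GRing.comm Nop X ->
  (forall v, insec v -> `|Re (dot v (X *m v))| <= b * nsq v) ->
  opb (mexpt X t) (expR (b * T)).
Proof.
move=> b0 tT hN hb.
apply: (@opb_le _ (expR (b * `|t|))); first by rewrite ler_expR ler_wpM2l.
have [t0|t0] := lerP 0 t.
  by rewrite ger0_norm //; apply: opb_mexpt => // v hv; exact: le_trans (ler_norm _) (hb v hv).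
rewrite ltr0_norm // -[in mexpt _ _](opprK t) mexpt_oppt; apply: opb_mexpt => [||v hv].
- by rewrite oppr_ge0 ltW.
- exact: commrN.
have -> : Re (dot v (- X *m v)) = - Re (dot v (X *m v)).
  by rewrite mulNmx -scaleN1r dotZr mulN1r; case: (dot _ _).
by apply: le_trans (hb v hv); rewrite -normrN ler_norm.
Qed.

End SectorBounds.

(** * Order conditions for formal exponentials *)

Section FormalExponentials.
Variables (K : numFieldType) (A : algType K).
Implicit Types (p q u v : {poly A}) (X Y Z : A) (l : seq A).

(** Congruence modulo the N-th power of the indeterminate: formal power series are represented by
    truncated polynomials. *)
Variant eqm (N : nat) p q : Prop :=
  Eqm of forall i, (i < N)%N -> p`_i = q`_i.

Lemma eqm_coef N p q : eqm N p q -> forall i, (i < N)%N -> p`_i = q`_i.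
Proof. by case. Qed.

Coercion eqm_coef : eqm >-> Funclass.

Lemma eqm_refl N p : eqm N p p. Proof. by []. Qed.

Lemma eqm_sym N p q : eqm N p q -> eqm N q p.
Proof. by move=> h; split=> i hi; rewrite (eqm_coef h). Qed.

Lemma eqm_trans N p q u : eqm N p q -> eqm N q u -> eqm N p u.
Proof. by move=> h1 h2; split=> i hi; rewrite (eqm_coef h1) ?(eqm_coef h2). Qed.

Lemma eqm_le M N p q : (M <= N)%N -> eqm N p q -> eqm M p q.
Proof. by move=> h1 h2; split=> i hi; apply: h2; apply: leq_trans h1. Qed.

Lemma eqm_mul N p q u v : eqm N p q -> eqm N u v -> eqm N (p * u) (q * v).
Proof.
move=> h1 h2; split=> i hi; rewrite !coefM; apply: eq_bigr => -[j /= hj] _.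
by rewrite (eqm_coef h1) ?(eqm_coef h2) // (leq_ltn_trans _ hi) // leq_subr.
Qed.

Lemma eqm_add N p q u v : eqm N p q -> eqm N u v -> eqm N (p + u) (q + v).
Proof. by move=> h1 h2; split=> i hi; rewrite !coefD (eqm_coef h1) ?(eqm_coef h2). Qed.

Lemma eqm_deriv N p q : eqm N.+1 p q -> eqm N p^`() q^`().
Proof. by move=> h; split=> i hi; rewrite !coef_deriv (eqm_coef h). Qed.

(** The truncation of exp(xY), where the indeterminate x stands for time and commutes with the
    coefficients. *)
Definition fexp N Y : {poly A} := \poly_(i < N) ((i`!%:R)^-1 *: Y ^+ i).

Lemma coef_fexp N Y i : (i < N)%N -> (fexp N Y)`_i = (i`!%:R)^-1 *: Y ^+ i.
Proof. by move=> h; rewrite coef_poly h. Qed.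

Lemma fexp_deriv N Y : eqm N (fexp N.+1 Y)^`() (Y%:P * fexp N.+1 Y).
Proof.
split=> i hi; rewrite coef_deriv coefCM !coef_fexp ?ltnS // ?(ltnW hi) //.
rewrite -scalerAr -exprS -scaler_nat scalerA factS natrM invfM mulrA.
by rewrite mulfV ?mul1r // pnatr_eq0.
Qed.

Lemma fexp_add N Y Z : GRing.comm Y Z ->
  eqm N (fexp N Y * fexp N Z) (fexp N (Y + Z)).
Proof.
move=> h; split=> i hi; rewrite coefM coef_fexp // addrC exprDn_comm; last exact: commr_sym.
rewrite scaler_sumr; apply: eq_bigr => -[j /= hj] _.
rewrite !coef_fexp; first last.
- by rewrite (leq_ltn_trans _ hi) // -ltnS.
- by rewrite (leq_ltn_trans _ hi) // leq_subr.
have -> : GRing.comm (Z ^+ (i - j)) (Y ^+ j) by apply: commrX; apply/commr_sym/commrX.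
rewrite -[in RHS](scaler_nat _ (_ * _)) -scalerAl -scalerAr !scalerA; congr (_ *: _).
have hji : (j <= i)%N by rewrite -ltnS.
have nz m : (m`!%:R : K) != 0 by rewrite pnatr_eq0 -lt0n fact_gt0.
have nzC : ('C(i, j)%:R : K) != 0 by rewrite pnatr_eq0 -lt0n bin_gt0.
have e : (i`!%:R : K) = 'C(i, j)%:R * (j`!%:R * (i - j)`!%:R).
  by rewrite -!natrM bin_fact.
by rewrite e; field; rewrite nzC !nz.
Qed.

Lemma fexp0 N : eqm N (fexp N 0) 1.
Proof.
split=> i hi; rewrite coef_fexp // expr0n coef1.
by case: i {hi} => [|i] /=; rewrite ?fact0 ?invr1 ?scale1r // scaler0.
Qed.

Lemma fexpN N Y : eqm N (fexp N Y * fexp N (- Y)) 1.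
Proof.
have h : GRing.comm Y (- Y) by apply: commrN.
by apply: eqm_trans (fexp_add N h) _; rewrite subrr; apply: fexp0.
Qed.

Lemma fexpNl N Y : eqm N (fexp N (- Y) * fexp N Y) 1.
Proof. by have := fexpN N (- Y); rewrite opprK. Qed.

Definition fP N l : {poly A} := \prod_(Y <- l) fexp N Y.

Lemma fP_cons N Y l : fP N (Y :: l) = fexp N Y * fP N l.
Proof. exact: big_cons. Qed.

Lemma fP_cat N l1 l2 : fP N (l1 ++ l2) = fP N l1 * fP N l2.
Proof. exact: big_cat. Qed.

Lemma fexp_coef0 N Y : (fexp N.+1 Y)`_0 = 1.
Proof. by rewrite coef_fexp // invr1 scale1r. Qed.

Lemma fP_coef0 N l : (fP N.+1 l)`_0 = 1.
Proof.
elim: l => [|Y l ih]; first by rewrite /fP big_nil coef1.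
by rewrite fP_cons coef0M fexp_coef0 ih mulr1.
Qed.

Definition scl (c : K) l := map ( *:%R c) l.

Lemma coef_scale_mul (c : K) p q u v :
  (forall i, u`_i = c ^+ i *: p`_i) -> (forall i, v`_i = c ^+ i *: q`_i) ->
  forall i, (u * v)`_i = c ^+ i *: (p * q)`_i.
Proof.
move=> h1 h2 i; rewrite !coefM scaler_sumr; apply: eq_bigr => -[j /= hj] _.
by rewrite h1 h2 -scalerAl -scalerAr scalerA -exprD subnKC.
Qed.

Lemma fexp_scl N c Y i : (fexp N (c *: Y))`_i = c ^+ i *: (fexp N Y)`_i.
Proof.
rewrite !coef_poly; case: ifP => _; last by rewrite scaler0.
by rewrite exprZn !scalerA mulrC.
Qed.

Lemma fP_scl N c l i : (fP N (scl c l))`_i = c ^+ i *: (fP N l)`_i.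
Proof.
elim: l i => [|Y l ih] i; last first.
  by rewrite /= !fP_cons (coef_scale_mul (c := c) (fexp_scl N c Y) ih).
rewrite /fP big_nil coef1; case: i => [|i] /=; by rewrite ?scale1r ?scaler0.
Qed.

(** The inverse of a product of exponentials reverses the order and the signs. For a palindrome only
    the signs change, which is the source of symmetry arguments. *)
Lemma fP_rev N l : eqm N (fP N l * fP N (rev (scl (-1) l))) 1.
Proof.
elim: l => [|Y l ih]; first by rewrite /fP !big_nil mulr1.
rewrite /= rev_cons -cats1 fP_cat !fP_cons [fP N [::]]big_nil mulr1 scaleN1r.
rewrite -mulrA [fP N l * _]mulrA; apply: eqm_trans (fexpN N Y).
apply: eqm_mul => //; rewrite -[X in eqm _ _ X]mul1r; exact: eqm_mul.
Qed.

(** The logarithmic derivative P' P^(-1) of P = [fP N l], as the product rule computes it factor by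
    factor. *)
Fixpoint fG N l : {poly A} :=
  if l is Y :: l' then Y%:P + fexp N Y * fG N l' * fexp N (- Y) else 0.

Lemma fP_deriv N l : eqm N (fP N.+1 l)^`() (fG N.+1 l * fP N.+1 l).
Proof.
elim: l => [|Y l ih]; first by rewrite /fP big_nil derivC mul0r.
rewrite fP_cons derivM /= mulrDl; apply: eqm_add.
  by rewrite mulrA; apply: eqm_mul => //; apply: fexp_deriv.
rewrite -!mulrA; apply: eqm_mul => //.
apply: eqm_trans ih _; apply: eqm_mul => //.
rewrite mulrA -[X in eqm _ X _]mul1r; apply: eqm_mul => //.
by apply: eqm_sym; apply: eqm_le (fexpNl _ _).
Qed.

(** Differentiating P = exp(xX) gives G P = X P with one order lost, and P is cancelled by the
    inverse from [fP_rev]. *)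
Lemma order_generator N l X :
  eqm N.+1 (fP N.+1 l) (fexp N.+1 X) -> eqm N (fG N.+1 l) X%:P.
Proof.
move=> h; have h1 : eqm N (fG N.+1 l * fP N.+1 l) (X%:P * fP N.+1 l).
  apply: eqm_trans (eqm_sym (fP_deriv _ _)) _.
  apply: eqm_trans (eqm_deriv h) _; apply: eqm_trans (fexp_deriv _ _) _.
  by apply: eqm_mul => //; apply: eqm_sym; apply: eqm_le h.
have h2 := eqm_le (leqnSn N) (fP_rev N.+1 l).
have cancel u : eqm N u (u * (fP N.+1 l * fP N.+1 (rev (scl (-1) l)))).
  rewrite -[X in eqm _ X _]mulr1; apply: eqm_mul => //; exact: eqm_sym.
apply: eqm_trans (cancel _) _; apply: eqm_sym; apply: eqm_trans (cancel _) _.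
by rewrite !mulrA; apply: eqm_mul => //; apply: eqm_sym.
Qed.

(** In degree m, a deviation of one factor meets only the constant term 1 of the other, so leading
    errors add. *)
Lemma coef_mul_perturb m p q u v : (0 < m)%N ->
  eqm m u p -> eqm m v q -> p`_0 = 1 -> q`_0 = 1 ->
  (u * v)`_m = (p * q)`_m + (u`_m - p`_m) + (v`_m - q`_m).
Proof.
case: m => // m _ h1 h2 hp hq.
rewrite !coefM ![\sum_(i < m.+2) _]big_ord_recl !big_ord_recr /= !subn0.
rewrite /bump /= !add1n !subnn.
have u0 : u`_0 = 1 by rewrite (eqm_coef h1).
have v0 : v`_0 = 1 by rewrite (eqm_coef h2).
rewrite u0 v0 hp hq !mul1r !mulr1.
rewrite (eq_bigr (fun j : 'I_m => p`_(1 + j) * q`_(m.+1 - (1 + j)))); last first.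
  by move=> [j /= hj] _; rewrite (eqm_coef h1) ?(eqm_coef h2) ?add1n ?ltnS // subSS leq_subr.
rewrite -[_ + _ + (u`_m.+1 - _)]addrA -[_ + p`_m.+1 + _]addrA subrKC.
by rewrite [LHS]addrC [q`_m.+1 + _]addrC -[RHS]addrA subrKC.
Qed.

(* The formal product satisfies P(t) P(- t) = 1 when the list is a palindrome, so an error
   coefficient E of even degree satisfies 2 E = 0. *)
Lemma symmetric_order N m l X : (m < N)%N -> ~~ odd m -> rev l = l ->
  eqm m (fP N l) (fexp N X) -> eqm m.+1 (fP N l) (fexp N X).
Proof.
case: N => // N hm ev hrev h; split=> i; rewrite ltnS leq_eqVlt => /orP[/eqP ->|]; last exact: h.
have [-> |m0] := posnP m; first by rewrite fP_coef0 fexp_coef0.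
have h' : eqm m (fP N.+1 (scl (-1) l)) (fexp N.+1 ((-1) *: X)).
  by split=> j hj; rewrite fP_scl fexp_scl (eqm_coef h).
have hs : rev (scl (-1) l) = scl (-1) l by rewrite /scl -map_rev hrev.
have e1 := eqm_coef (fP_rev N.+1 l) hm; rewrite hs in e1.
have e2 := eqm_coef (fexpN N.+1 X) hm; rewrite -scaleN1r in e2.
have := coef_mul_perturb m0 h h' (fexp_coef0 _ _) (fexp_coef0 _ _).
rewrite e1 e2 -addrA -[LHS]addr0 => /addrI.
rewrite fP_scl fexp_scl -signr_odd (negbTE ev) !scale1r.
rewrite -mulr2n => /esym/eqP; rewrite -scaler_nat scaler_eq0 pnatr_eq0 /= subr_eq0.
by move=> /eqP.
Qed.

Lemma order_one N l : eqm 2 (fP N.+2 l) (fexp N.+2 (\sum_(Y <- l) Y)).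
Proof.
split=> -[|[|//]] _; first by rewrite fP_coef0 fexp_coef0.
rewrite coef_fexp // invr1 scale1r expr1.
elim: l => [|Y l ih]; first by rewrite /fP !big_nil coef1.
rewrite fP_cons big_cons coefM big_ord_recl big_ord1 /= fP_coef0 fexp_coef0.
by rewrite ih mul1r mulr1 coef_fexp // invr1 scale1r expr1 addrC.
Qed.

Definition suzuki_list (s : K) l :=
  scl s l ++ scl s l ++ scl (1 - 4 * s) l ++ scl s l ++ scl s l.

(** The leading error E of the formula, in degree m, is scaled by c^m in a copy run for time c. The
    five errors add up to (4 s^m + (1-4s)^m) E = 0, which gains one order; the next degree m+1 is
    even, so the palindrome gains a second one. *)
Lemma suzuki_order N m l X (s : K) : (m.+1 < N)%N -> odd m -> rev l = l ->
  4 * s ^+ m + (1 - 4 * s) ^+ m = 0 ->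
  eqm m (fP N l) (fexp N X) ->
  rev (suzuki_list s l) = suzuki_list s l /\
  eqm m.+2 (fP N (suzuki_list s l)) (fexp N X).
Proof.
case: N => // N hm om hrev hs h.
have m0 : (0 < m)%N by case: m om {hm hs h}.
have rs c : rev (scl c l) = scl c l by rewrite -map_rev hrev.
have hr : rev (suzuki_list s l) = suzuki_list s l.
  by rewrite /suzuki_list !rev_cat !rs !catA.
split=> //; apply: symmetric_order => //; first by rewrite /= om.
have hc c : eqm m (fP N.+1 (scl c l)) (fexp N.+1 (c *: X)).
  by split=> j hj; rewrite fP_scl fexp_scl (eqm_coef h).
pose E := (fP N.+1 l)`_m - (fexp N.+1 X)`_m.
(* [good u a c]: to leading order, [u] differs from [exp (a X)] by [c E]. *)
pose good u a c := eqm m u (fexp N.+1 (a *: X)) /\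
  u`_m = (fexp N.+1 (a *: X))`_m + c *: E.
have good1 c : good (fP N.+1 (scl c l)) c (c ^+ m).
  by split; [exact: hc | rewrite fP_scl fexp_scl scalerBr addrC subrK].
have goodM u v a b c d : good u a c -> good v b d -> good (u * v) (a + b) (c + d).
  move=> [h1 h2] [h3 h4].
  have hab : eqm N.+1 (fexp N.+1 (a *: X) * fexp N.+1 (b *: X)) (fexp N.+1 ((a + b) *: X)).
    by rewrite scalerDl; apply/fexp_add/commr_sym; rewrite /GRing.comm -!scalerAl -!scalerAr !scalerA mulrC.
  split.
    by apply: eqm_trans (eqm_mul h1 h3) _; apply: eqm_le hab; apply: ltnW; apply: ltnW.
  rewrite (coef_mul_perturb m0 h1 h3) ?fexp_coef0 // h2 h4 (eqm_coef hab); last exact: ltnW.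
  have k (x y : A) : x + y - x = y by rewrite addrAC subrr add0r.
  by rewrite !k [(c + d) *: E]scalerDl addrA.
have := goodM _ _ _ _ _ _ (good1 s) (goodM _ _ _ _ _ _ (good1 s)
  (goodM _ _ _ _ _ _ (good1 (1 - 4 * s)) (goodM _ _ _ _ _ _ (good1 s) (good1 s)))).
rewrite -!fP_cat -/(suzuki_list s l).
have -> : s + (s + (1 - 4 * s + (s + s))) = 1 by ring.
have -> : s ^+ m + (s ^+ m + ((1 - 4 * s) ^+ m + (s ^+ m + s ^+ m))) = 0.
  by rewrite -hs; ring.
rewrite /good scale1r scale0r addr0 => -[g1 g2]; split=> j; rewrite ltnS leq_eqVlt.
by move=> /orP[/eqP -> //|]; apply: g1.
Qed.

End FormalExponentials.

(** * Error of a product of exponentials *)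

Section AdjointExpansion.
Variables (K : numFieldType) (A : algType K).
Implicit Types (X Y Z : A) (q : {poly A}).

Definition brk X Y : A := X * Y - Y * X.

(** This is ad_Z^i(Y) / i!, the Taylor coefficient of e^(tZ) Y e^(-tZ). New brackets are put
    innermost because differentiating the conjugate of [Y] gives the conjugate of [brk Z Y]. *)
Fixpoint adt Z i Y : A :=
  if i is i'.+1 then (i'.+1%:R)^-1 *: adt Z i' (brk Z Y) else Y.

(** This and the next three identities are the algebra behind the derivatives of a conjugation, of a
    product of exponentials and of e^(-tX) P(t), and behind the return from that product to the
    error. *)
Lemma conj_derivE Z X Y Y' X' : GRing.comm Z X ->
  (Z * X * Y + X * Y') * X' + X * Y * (- (Z * X')) = X * (brk Z Y + Y') * X'.
Proof.
move=> h; rewrite h /brk mulrDl mulrDr mulrDl mulrBr mulrBl mulrN !mulrA addrAC.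
by [].
Qed.

Lemma prod_derivE Z X X' Y P : X' * X = 1 ->
  Z * X * P + X * (Y * P) = (Z + X * Y * X') * (X * P).
Proof. by move=> h; rewrite mulrDl !mulrA -[X * Y * X' * X]mulrA h mulr1. Qed.

Lemma intertwine_derivE X Y G P : GRing.comm X Y ->
  (- (X * Y)) * P + Y * (G * P) = Y * ((G - X) * P).
Proof. by move=> h; rewrite h mulrBl mulrBr !mulrA mulNr addrC. Qed.

Lemma interaction_diffE X X' P : X * X' = 1 -> -1 *: (X * (X' * P - 1)) = X - P.
Proof. by move=> h; rewrite mulrBr mulr1 mulrA h mul1r scaleN1r opprB. Qed.

(** Hadamard's lemma. The formal derivative of the conjugate of [Y] is the conjugate of [brk Z Y],
    so each coefficient follows from the previous one. *)
Lemma coef_conj_fexpC N Z Y i : (i < N.+1)%N ->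
  (fexp N.+1 Z * Y%:P * fexp N.+1 (- Z))`_i = adt Z i Y.
Proof.
elim: i Y => [|i ih] Y hi.
  by rewrite !coef0M !fexp_coef0 coefC mul1r mulr1.
have nz : (i.+1%:R : K) != 0 by rewrite pnatr_eq0.
apply: (scalerI nz); rewrite /= scalerA mulfV // scale1r -ih; last exact: ltnW.
rewrite scaler_nat -coef_deriv.
have h : eqm N (fexp N.+1 Z * Y%:P * fexp N.+1 (- Z))^`()
               (fexp N.+1 Z * (brk Z Y)%:P * fexp N.+1 (- Z)).
  rewrite !derivM derivC mulr0 addr0.
  have hZ : eqm N (fexp N.+1 Z)^`() (fexp N.+1 Z * Z%:P).
    apply: eqm_trans (fexp_deriv _ _) _; split=> j hj; rewrite coefCM coefMC.
    rewrite coef_fexp ?(ltnW (ltnS _ _)) //; last exact: ltnW.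
    by rewrite -scalerAl -scalerAr -exprS -exprSr.
  apply: eqm_trans (eqm_add (eqm_mul (eqm_mul hZ (eqm_refl _ _)) (eqm_refl _ _))
    (eqm_mul (eqm_refl _ _) (fexp_deriv _ _))) _.
  rewrite /brk polyCB !polyCM polyCN mulrBr mulrBl.
  by rewrite mulNr mulrN !mulrA.
exact: (eqm_coef h).
Qed.

Lemma coef_conj_fexp N Z q m : (m < N.+1)%N ->
  (fexp N.+1 Z * q * fexp N.+1 (- Z))`_m =
  \sum_(0 <= j < m.+1) adt Z (m - j) q`_j.
Proof.
have adt0 i : adt Z i 0 = 0.
  by elim: i => //= i ih; rewrite /brk mulr0 mul0r subrr ih scaler0.
elim/poly_ind: q m => [|q c ih] m hm.
  by rewrite mulr0 mul0r coef0 big1_seq // => j _; rewrite coef0 adt0.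
rewrite mulrDr mulrDl coefD (coef_conj_fexpC _ c) //.
rewrite mulrA -[fexp _ _ * q * 'X * _]mulrA -commr_polyX mulrA coefMX.
rewrite big_nat_recl //= coefD coefMX coefC /= add0r subn0.
case: m hm => [|m] hm /=; first by rewrite big_geq // addr0 add0r.
rewrite ih; last exact: ltnW.
rewrite addrC; congr (_ + _); apply: eq_bigr => j _.
by rewrite coefD coefMX coefC /= addr0 subSS.
Qed.

End AdjointExpansion.

(** * Taylor remainder of the generator and the resulting error bound *)

Section ProductFormulaError.
Variables (R : realType) (n : nat).
Local Notation C := R[i].
Local Notation A := 'M[C]_n.+1.
Variables (Nop : A) (eta : C) (I : Type) (Xf : I -> A).
Implicit Types (X Y Z : A) (l : seq A).
Local Notation opb := (opb Nop eta).

(** The bound [b] concerns brackets of depth exactly [r]; at smaller depth only conservation of the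
    particle number is required. Hence a scalar satisfies it with [b] = 0 as soon as [r] > 0. *)
Fixpoint nest (r : nat) Y (b : R) : Prop :=
  if r is r'.+1 then GRing.comm Nop Y /\ forall j, nest r' (brk (Xf j) Y) b
  else opb Y b.

Lemma nest_comm r Y b : nest r Y b -> GRing.comm Nop Y.
Proof. by case: r => [|r] []. Qed.

Lemma brkDr X Y Z : brk X (Y + Z) = brk X Y + brk X Z.
Proof. by rewrite /brk mulrDr mulrDl opprD addrACA. Qed.

Lemma brkZr z X Y : brk X (z *: Y) = z *: brk X Y.
Proof. by rewrite /brk -scalerAr -scalerAl scalerBr. Qed.

Lemma brkZl z X Y : brk (z *: X) Y = z *: brk X Y.
Proof. by rewrite /brk -scalerAr -scalerAl scalerBr. Qed.

Lemma nest_le r Y b b' : b <= b' -> nest r Y b -> nest r Y b'.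
Proof.
move=> hb; elim: r Y => [|r ih] Y /=; first exact: opb_le.
by move=> [h1 h2]; split=> // j; apply/ih/h2.
Qed.

Lemma nestD r Y Z b c : nest r Y b -> nest r Z c -> nest r (Y + Z) (b + c).
Proof.
elim: r Y Z => [|r ih] Y Z /=; first exact: opbD.
move=> [h1 h2] [h3 h4]; split=> [|j]; first exact: commrD.
by rewrite brkDr; apply: ih.
Qed.

Lemma nestZ r z Y b : nest r Y b -> nest r (z *: Y) (normc z * b).
Proof.
elim: r Y => [|r ih] Y /=; first exact: opbZ.
by move=> [h1 h2]; split=> [|j]; [exact: commrZ | rewrite brkZr; apply: ih].
Qed.

Lemma nest0 r : nest r 0 0.
Proof.
elim: r => [|r ih] /=; first exact: opb0.
by split=> [|j]; [exact: commr0 | rewrite /brk mulr0 mul0r subrr].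
Qed.

Lemma nest_sum_nat r (N : nat) (F : nat -> A) (c : nat -> R) :
  (forall j, (j < N)%N -> nest r (F j) (c j)) ->
  nest r (\sum_(0 <= j < N) F j) (\sum_(0 <= j < N) c j).
Proof.
elim: N => [|N ih] h; first by rewrite !big_geq //; exact: nest0.
rewrite !big_nat_recr //=; apply: nestD; last exact: h.
by apply: ih => j hj; apply: h; apply: leqW.
Qed.

Variables (T K B mu : R) (p : nat).
Hypotheses (T0 : 0 <= T) (K1 : 1 <= K) (B0 : 0 <= B) (mu1 : 1 <= mu).

Let K0 : 0 <= K. Proof. exact: le_trans K1. Qed.
Let mu0 : 0 <= mu. Proof. exact: le_trans mu1. Qed.

(** [Z] stands for a factor c X_g with |c| at most [mu]. [B] bounds the p-fold commutators of the
    X_g, and [K] bounds the exponentials up to time [T] in both directions. *)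
Record adm Z := Adm {
  adm_comm : GRing.comm Nop Z;
  adm_nest : nest p Z (mu * B);
  adm_brk : forall r Y b, 0 <= b -> nest r.+1 Y b -> nest r (brk Z Y) (mu * b);
  adm_exp : forall s, `|s| <= T -> opb (mexpt Z s) K }.

Lemma normc_invn (i : nat) : normc ((i.+1%:R)^-1 : C) <= 1.
Proof.
rewrite ComplexField.Normc.normcV -(rmorph_nat (real_complex R)) normc_real.
by rewrite ger0_norm // invf_le1 ?ltr0n // ler1n.
Qed.

(** Each bracket with [Z] uses up one level of depth and costs a factor [mu]; the factorials are
    discarded. *)
Lemma nest_adt Z r i Y b : adm Z -> 0 <= b -> nest (r + i) Y b ->
  nest r (adt Z i Y) (mu ^+ i * b).
Proof.
move=> hZ; elim: i Y b => [|i ih] Y b b0 h /=.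
  by rewrite addn0 in h; rewrite expr0 mul1r.
have hb : 0 <= mu * b by rewrite mulr_ge0.
rewrite addnS in h.
apply: nest_le (nestZ _ (ih _ _ hb (adm_brk hZ b0 h))).
rewrite exprSr -mulrA -[leRHS]mul1r ler_wpM2r ?normc_invn //.
by rewrite mulr_ge0 ?exprn_ge0.
Qed.

Definition conjt Z Y (t : R) : A := mexpt Z t * Y * mexpt Z (- t).

Lemma mderiv_conjt Z (F : R -> A) F' t : mderiv F t F' ->
  mderiv (fun x => conjt Z (F x) x) t (conjt Z (brk Z (F t) + F') t).
Proof.
move=> hF.
apply: mderiv_eq (mderiv_mul (mderiv_mul (mderiv_mexpt Z t) hF) (mderiv_mexptN Z t)) _.
exact/conj_derivE/mexpt_comm.
Qed.

Lemma conjt_bound Z Y t b : adm Z -> 0 <= b -> 0 <= t <= T -> opb Y b ->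
  opb (conjt Z Y t) (K ^+ 2 * b).
Proof.
move=> hZ b0 /andP[t0 tT] hY.
have -> : K ^+ 2 * b = K * b * K by rewrite expr2; ring.
have h1 := adm_exp hZ (s := t); have h2 := adm_exp hZ (s := - t).
rewrite normrN in h2; rewrite ger0_norm // in h1 h2.
by apply: opbM (opbM _ (h1 tT) hY) (h2 tT) => //; rewrite mulr_ge0.
Qed.

Definition conj_rem r Z Y (t : R) : A :=
  conjt Z Y t - \sum_(0 <= i < r) (t ^+ i)%:C *: adt Z i Y.

Lemma is_derive_expn (k : nat) (t : R) :
  is_derive t (1 : R) (fun x => x ^+ k.+1) (k.+1%:R * t ^+ k).
Proof.
elim: k => [|k ih].
  by rewrite expr0 mulr1; under eq_fun do rewrite expr1; exact: is_derive_id.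
under eq_fun do rewrite exprS.
have := is_derive_mul (is_derive_id t 1) ih.
by move/is_derive_eq; apply; rewrite -[k.+2]add1n natrD exprS; ring.
Qed.

(** Differentiation trades one order of the Taylor remainder for one bracket with [Z]. This is the
    induction step of the next bound, which ends at depth 0 with a plain conjugate. *)
Lemma mderiv_conj_rem r Z Y t : mderiv (conj_rem r.+1 Z Y) t (conj_rem r Z (brk Z Y) t).
Proof.
rewrite /conj_rem; apply: mderivB.
  by have := mderiv_conjt Z (mderiv_cst Y t); rewrite addr0.
have -> : (fun x : R => \sum_(0 <= i < r.+1) (x ^+ i)%:C *: adt Z i Y) =
   fun x => Y + \sum_(0 <= i < r) (x ^+ i.+1)%:C *: adt Z i.+1 Y.
  by apply/funext => x; rewrite big_nat_recl //= expr0 scale1r.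
rewrite -[X in mderiv _ _ X]add0r; apply: mderivD; first exact: mderiv_cst.
apply: mderiv_sum => i /=.
apply: mderiv_eq (mderivZ _ (is_derive_expn i t)) _.
rewrite scalerA rmorphM rmorph_nat mulrAC mulfV ?mul1r //.
by rewrite pnatr_eq0.
Qed.

Lemma conj_rem_bound r Z Y b t : adm Z -> 0 <= b -> nest r Y b -> 0 <= t <= T ->
  opb (conj_rem r Z Y t) (K ^+ 2 * mu ^+ r * b * t ^+ r).
Proof.
move=> hZ; elim: r Y b t => [|r ih] Y b t b0 hY ht.
  rewrite /conj_rem big_geq // subr0 !expr0 !mulr1; exact: conjt_bound.
have hb : 0 <= mu * b by rewrite mulr_ge0.
have hbr := adm_brk hZ b0 hY.
apply: (@opb_mean _ _ _ _ _ (conj_rem r Z (brk Z Y)) T) => //.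
- by rewrite !mulr_ge0 ?exprn_ge0.
- by move=> s; exact: mderiv_conj_rem.
- rewrite /conj_rem /conjt oppr0 mexpt0 mul1r mulr1 big_nat_recl //= expr0 scale1r.
  by rewrite big1 ?addr0 ?subrr // => i _; rewrite exprS mul0r scale0r.
- move=> s; apply: commrB.
    by apply: commrM (mexpt_comm _ (adm_comm hZ)); apply: commrM (nest_comm hY);
       apply: mexpt_comm (adm_comm hZ).
  apply: big_ind => [|x y|i _]; [exact: commr0 | exact: commrD |].
  apply: commrZ.
  have hc : GRing.comm Nop Z := adm_comm hZ.
  elim: i Y {hY hbr} (nest_comm hY) => [//|i ihi] Y hY /=.
  by apply: commrZ; apply: ihi; apply: commrB; apply: commrM.
move=> s hs; have -> : K ^+ 2 * mu ^+ r.+1 * b * s ^+ r = K ^+ 2 * mu ^+ r * (mu * b) * s ^+ r.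
  by rewrite [mu ^+ r.+1]exprSr; ring.
exact: ih.
Qed.

(** The matrix counterpart of [fG], that is P'(t) P(t)^(-1) for P = [prodt l]. *)
Fixpoint gen l (t : R) : A := if l is Z :: l' then Z + conjt Z (gen l' t) t else 0.

Definition prodt l (t : R) : A := \prod_(Z <- l) mexpt Z t.

Lemma mderiv_prodt l t : mderiv (prodt l) t (gen l t * prodt l t).
Proof.
elim: l => [|Z l ih].
  have -> : prodt [::] = fun=> 1 by apply/funext => x; rewrite /prodt big_nil.
  by rewrite mul0r; exact: mderiv_cst.
have -> : prodt (Z :: l) = fun x => mexpt Z x * prodt l x.
  by apply/funext => x; rewrite /prodt big_cons.
apply: mderiv_eq (mderiv_mul (mderiv_mexpt Z t) ih) _.
exact/prod_derivE/mexptVl.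
Qed.

(** The first [mu] comes from the head of the list. Conjugating the coefficients of the tail gives
    at most [p] terms, each with at most [p] new brackets, hence [mu ^+ p]. *)
Fixpoint coef_cst (k : nat) : R :=
  if k is k'.+1 then mu + p%:R * (mu ^+ p * coef_cst k') else 0.

(** One [K ^+ 2] for conjugating the remainder of the tail, and another in each of the [p] Taylor
    remainders created by conjugating its coefficients. *)
Fixpoint rem_cst (k : nat) : R :=
  if k is k'.+1 then K ^+ 2 * rem_cst k' + p%:R * (K ^+ 2 * mu ^+ p * coef_cst k') else 0.

Lemma coef_cst_ge0 k : 0 <= coef_cst k.
Proof. by elim: k => //= k ih; rewrite addr_ge0 ?mulr_ge0 ?exprn_ge0. Qed.

Lemma rem_cst_ge0 k : 0 <= rem_cst k.
Proof. by elim: k => //= k ih; rewrite addr_ge0 ?mulr_ge0 ?exprn_ge0 ?coef_cst_ge0. Qed.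

Definition all_adm l := foldr (fun Z P => adm Z /\ P) True l.

(** The coefficient of degree m is built from m-fold brackets, so p - m further ones lead to depth
    p, where [B] is available. *)
Lemma nest_coef l m : all_adm l -> (m < p)%N ->
  nest (p - m) (fG p.+1 l)`_m (coef_cst (size l) * B).
Proof.
elim: l m => [|Z l ih] m /=; first by rewrite coef0 mul0r => _ _; exact: nest0.
move=> [hZ hl] hm; rewrite coefD coef_conj_fexp; last by rewrite ltnW.
rewrite mulrDl; apply: nestD.
  rewrite coefC; case: m hm => [|m] hm /=; first by rewrite subn0; exact: adm_nest.
  by apply: nest_le (nest0 _); rewrite mulr_ge0.
have hc := coef_cst_ge0 (size l).
apply: (@nest_le _ _ (\sum_(0 <= j < m.+1) mu ^+ p * (coef_cst (size l) * B))).
  rewrite sumr_const_nat subn0 -[leLHS]mulr_natl -!mulrA ler_wpM2r ?ler_nat //.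
  by rewrite !mulr_ge0 ?exprn_ge0.
apply: nest_sum_nat => j hj.
have hb : 0 <= coef_cst (size l) * B by rewrite mulr_ge0.
apply: (@nest_le _ _ (mu ^+ (m - j) * (coef_cst (size l) * B))).
  rewrite ler_wpM2r // ler_weXn2l //.
  by rewrite (leq_trans (leq_subr _ _)) // ltnW.
apply: nest_adt => //.
(* The m - j brackets that lift the coefficient of degree j to degree m come out of its own budget p
   - j. *)
have -> : (p - m + (m - j) = p - j)%N.
  by rewrite addnBA // subnK // ltnW.
by apply: ih => //; apply: leq_ltn_trans hm.
Qed.

Definition gen_rem l (t : R) : A :=
  gen l t - \sum_(0 <= m < p) (t ^+ m)%:C *: (fG p.+1 l)`_m.

Lemma sum_triangle (F : nat -> nat -> A) :
  \sum_(0 <= m < p) \sum_(0 <= j < m.+1) F m j =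
  \sum_(0 <= j < p) \sum_(0 <= i < p - j) F (i + j)%N j.
Proof.
transitivity (\sum_(0 <= m < p) \sum_(0 <= j < p | (j <= m)%N) F m j).
  rewrite big_nat_cond [RHS]big_nat_cond; apply: eq_bigr => m /andP[/andP[_ hm] _].
  by rewrite (big_nat_widen 0 m.+1 p).
rewrite (exchange_big_dep_nat predT) //=; apply: eq_bigr => j _.
rewrite [RHS](_ : _ = \sum_(j <= m < p) F m j); last first.
  by rewrite -[in RHS](add0n j) big_addn.
by rewrite [RHS](big_nat_widenl _ 0).
Qed.

(** The coefficient of degree j carries t^j, so its conjugation is expanded only to order p - j. The
    polynomial parts then cancel after summing over the triangle i + j < p, and every remainder left
    is of order t^p at depth p. *)
Lemma gen_rem_cons Z l t : (0 < p)%N -> gen_rem (Z :: l) t =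
  conjt Z (gen_rem l t) t +
  \sum_(0 <= j < p) (t ^+ j)%:C *: conj_rem (p - j) Z (fG p.+1 l)`_j t.
Proof.
move=> p0; set q := fG p.+1 l.
have conjtD Y Y' : conjt Z (Y + Y') t = conjt Z Y t + conjt Z Y' t.
  by rewrite /conjt mulrDr mulrDl.
have conjtN Y : conjt Z (- Y) t = - conjt Z Y t by rewrite /conjt mulrN mulNr.
have conjtZ z Y : conjt Z (z *: Y) t = z *: conjt Z Y t.
  by rewrite /conjt -scalerAr -scalerAl.
have conjtS (F : nat -> A) : conjt Z (\sum_(0 <= j < p) F j) t =
    \sum_(0 <= j < p) conjt Z (F j) t.
  by rewrite /conjt mulr_sumr mulr_suml.
rewrite {2}/gen_rem conjtD conjtN conjtS -addrA /conj_rem.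
have -> : \sum_(0 <= j < p) (t ^+ j)%:C *:
    (conjt Z q`_j t - \sum_(0 <= i < p - j) (t ^+ i)%:C *: adt Z i q`_j) =
  \sum_(0 <= j < p) conjt Z ((t ^+ j)%:C *: q`_j) t -
  \sum_(0 <= j < p) \sum_(0 <= i < p - j) (t ^+ (i + j))%:C *: adt Z i q`_j.
  rewrite -sumrB; apply: eq_bigr => j _; rewrite scalerBr conjtZ; congr (_ - _).
  rewrite scaler_sumr; apply: eq_bigr => i _.
  by rewrite scalerA -rmorphM -exprD addnC.
have <- : \sum_(0 <= m < p) \sum_(0 <= j < m.+1) (t ^+ m)%:C *: adt Z (m - j) q`_j =
    \sum_(0 <= j < p) \sum_(0 <= i < p - j) (t ^+ (i + j))%:C *: adt Z i q`_j.
  rewrite (sum_triangle (fun m j => (t ^+ m)%:C *: adt Z (m - j) q`_j)).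
  by apply: eq_bigr => j _; apply: eq_bigr => i _; rewrite addnK.
rewrite addKr /gen_rem /=.
rewrite addrAC addrC; congr (_ + _).
have -> : \sum_(0 <= m < p) (t ^+ m)%:C *: (Z%:P + fexp p.+1 Z * q * fexp p.+1 (- Z))`_m =
    Z + \sum_(0 <= m < p) \sum_(0 <= j < m.+1) (t ^+ m)%:C *: adt Z (m - j) q`_j.
  have e : \sum_(0 <= m < p) (t ^+ m)%:C *: (Z%:P)`_m = Z.
    rewrite -(prednK p0) big_nat_recl // expr0 scale1r coefC /= big1 ?addr0 // => i _.
    by rewrite coefC scaler0.
  rewrite -[X in _ = X + _]e -big_split /= big_nat_cond [RHS]big_nat_cond.
  apply: eq_bigr => m /andP[/andP[_ hm] _].
  rewrite coefD scalerDr -scaler_sumr coef_conj_fexp //.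
  exact: ltnW.
by rewrite opprD addNKr.
Qed.

Lemma gen_rem_bound l t : (0 < p)%N -> all_adm l -> 0 <= t <= T ->
  opb (gen_rem l t) (rem_cst (size l) * B * t ^+ p).
Proof.
move=> p0 hl ht; elim: l hl => [|Z l ih] /=.
  rewrite /gen_rem /= big1 ?subr0 ?mul0r; first by move=> _; exact: opb0.
  by move=> m _; rewrite coef0 scaler0.
move=> [hZ hl]; rewrite gen_rem_cons // !mulrDl.
have t0 : 0 <= t by case/andP: ht.
have hr := rem_cst_ge0 (size l); have hc := coef_cst_ge0 (size l).
have hcB : 0 <= coef_cst (size l) * B by rewrite mulr_ge0.
apply: opbD.
  have -> : K ^+ 2 * rem_cst (size l) * B * t ^+ p =
      K ^+ 2 * (rem_cst (size l) * B * t ^+ p) by rewrite !mulrA.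
  apply: conjt_bound => //; first by rewrite !mulr_ge0 ?exprn_ge0.
  exact: ih.
apply: (@opb_le _ _ _ _ _ (\sum_(0 <= j < p) K ^+ 2 * mu ^+ p * (coef_cst (size l) * B) * t ^+ p)).
  rewrite sumr_const_nat subn0 -[leLHS]mulr_natl le_eqVlt; apply/orP; left.
  by apply/eqP; ring.
apply: opb_sum_nat => j hj.
apply: opb_le (opbZ _ (conj_rem_bound hZ hcB (nest_coef hl hj) ht)).
rewrite normc_real ger0_norm ?exprn_ge0 // [leLHS]mulrC -[leLHS]mulrA -exprD subnK 1?ltnW //.
rewrite ler_wpM2r ?exprn_ge0 // ler_wpM2r // ler_wpM2l ?exprn_ge0 //.
by rewrite ler_weXn2l // leq_subr.
Qed.

Lemma opb_prodt l t : all_adm l -> 0 <= t <= T -> opb (prodt l t) (K ^+ size l).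
Proof.
move=> hl /andP[t0 tT]; elim: l hl => [|Z l ih] /=.
  by rewrite /prodt big_nil expr0 => _; exact: opb1.
move=> [hZ hl]; rewrite /prodt big_cons exprS; apply: opbM => //; last exact: ih.
by apply: adm_exp => //; rewrite ger0_norm.
Qed.

Lemma comm_prodt l t : all_adm l -> GRing.comm Nop (prodt l t).
Proof.
elim: l => [|Z l ih] /=; first by rewrite /prodt big_nil => _; exact: commr1.
move=> [hZ hl]; rewrite /prodt big_cons; apply: commrM; last exact: ih.
exact/mexpt_comm/adm_comm.
Qed.

Lemma product_formula_error l X : (0 < p)%N -> all_adm l ->
  GRing.comm Nop X -> (forall s, `|s| <= T -> opb (mexpt X s) K) ->
  eqm p.+1 (fP p.+1 l) (fexp p.+1 X) ->
  opb (mexpt X T - prodt l T)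
    (K ^+ (size l).+2 * rem_cst (size l) * B * T ^+ p.+1).
Proof.
move=> p0 hl hX hXK /order_generator hG.
have TT : 0 <= T <= T by rewrite T0 lexx.
have hr := rem_cst_ge0 (size l).
(* Interaction picture: the derivative of [V] contains [gen l t - X], which the order conditions
   identify with [gen_rem l t]. *)
pose V t := mexpt X (- t) * prodt l t - 1.
pose V' t := mexpt X (- t) * (gen_rem l t * prodt l t).
have hgen t : gen_rem l t = gen l t - X.
  rewrite /gen_rem; congr (_ - _).
  transitivity (\sum_(0 <= m < p) (t ^+ m)%:C *: (X%:P)`_m).
    rewrite big_nat_cond [RHS]big_nat_cond; apply: eq_bigr => m /andP[/andP[_ hm] _].
    by rewrite (eqm_coef hG).
  rewrite -(prednK p0) big_nat_recl // expr0 scale1r coefC /= big1 ?addr0 // => i _.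
  by rewrite coefC scaler0.
have hV t : mderiv V t (V' t).
  have := mderivB (mderiv_mul (mderiv_mexptN X t) (mderiv_prodt l t)) (mderiv_cst (1 : A) t).
  move/mderiv_eq; apply; rewrite subr0 /V' hgen.
  exact/intertwine_derivE/mexpt_comm.
have hV0 : V 0 = 0.
  rewrite /V oppr0 mexpt0 mul1r /prodt big1 ?subrr // => Z _; exact: mexpt0.
have hVN t : GRing.comm Nop (V t).
  apply: commrB; last exact: commr1.
  by apply: commrM (comm_prodt _ hl); exact: mexpt_comm.
(* One [K] for e^(-tX) and one per factor of the product; the last multiplication by e^(TX) supplies
   the remaining one of [(size l).+2]. *)
pose c := K * (rem_cst (size l) * B) * K ^+ size l.
have hV'b s : 0 <= s <= T -> opb (V' s) (c * s ^+ p).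
  move=> hs; have /andP[s0 sT] := hs.
  have -> : c * s ^+ p = K * ((rem_cst (size l) * B * s ^+ p) * K ^+ size l).
    by rewrite /c; ring.
  apply: opbM => //; first by apply: hXK; rewrite normrN ger0_norm.
  apply: opbM; first by rewrite !mulr_ge0 ?exprn_ge0.
    exact: gen_rem_bound.
  exact: opb_prodt.
have c0 : 0 <= c by rewrite !mulr_ge0 ?exprn_ge0.
have := opb_mean c0 hV hV0 hVN hV'b TT.
have hT : `|T| <= T by rewrite ger0_norm.
move=> /(opbM K0 (hXK T hT)) /(opbZ (-1)).
rewrite normcN ComplexField.Normc.normc1 mul1r.
have -> : -1 *: (mexpt X T * V T) = mexpt X T - prodt l T.
  exact/interaction_diffE/mexptVr.
suff -> : K * (c * T ^+ p.+1) = K ^+ (size l).+2 * rem_cst (size l) * B * T ^+ p.+1 by [].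
by rewrite /c [K ^+ (size l).+2]exprS [K ^+ (size l).+1]exprS; ring.
Qed.

End ProductFormulaError.

(** * Local fermionic operators *)

Section LocalOperators.
Variables (R : realType) (n : nat) (M : finType).
Local Notation C := R[i].
Local Notation Re := (@complex.Re R).
Local Notation A := 'M[C]_n.+1.
Variable (a : M -> A).
Hypothesis car : CAR a.
Implicit Types (X Y Z : A) (v w : 'cV[C]_n.+1) (x y : M).

Local Notation ad x := ((a x)^t*).
Local Notation N x := (number_op a x).
Local Notation Ntot := (\sum_(x : M) number_op a x).

Lemma mulv X Y v : (X * Y) *m v = X *m (Y *m v).
Proof. by rewrite -mulmxA. Qed.

Lemma trCM X Y : (X * Y)^t* = Y^t* * X^t*.
Proof. exact: trC_mul. Qed.

Lemma trCD X Y : (X + Y)^t* = X^t* + Y^t*.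
Proof. by apply/matrixP => i j; rewrite !mxE rmorphD. Qed.

Lemma trCB X Y : (X - Y)^t* = X^t* - Y^t*.
Proof. by apply/matrixP => i j; rewrite !mxE rmorphB. Qed.

Lemma trCN X : (- X)^t* = - (X^t*).
Proof. by apply/matrixP => i j; rewrite !mxE rmorphN. Qed.

Lemma trC0 : (0 : A)^t* = 0.
Proof. by apply/matrixP => i j; rewrite !mxE rmorph0. Qed.

Lemma trC_sum (I : Type) (r : seq I) (P : pred I) (F : I -> A) :
  (\sum_(i <- r | P i) F i)^t* = \sum_(i <- r | P i) (F i)^t*.
Proof. exact: (big_morph (fun X : A => X^t*) trCD trC0). Qed.

Lemma trC1 : (1 : A)^t* = 1.
Proof. by rewrite trmx1 map_mx1. Qed.

Lemma trCZ z X : (z *: X)^t* = z^*%C *: X^t*.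
Proof. by apply/matrixP => i j; rewrite !mxE rmorphM. Qed.

Lemma anticomm_aa x y : a x * a y = - (a y * a x).
Proof. by have [h _] := car; apply/eqP; rewrite -addr_eq0 h. Qed.

Lemma anticomm_ad x y : x != y -> a x * ad y = - (ad y * a x).
Proof.
by have [_ h] := car; move=> /negbTE xy; apply/eqP; rewrite -addr_eq0 h xy.
Qed.

Lemma anticomm_dd x y : ad x * ad y = - (ad y * ad x).
Proof. by rewrite -!trCM anticomm_aa trCN. Qed.

Lemma a_ad x : a x * ad x = 1 - N x.
Proof.
have [_ h] := car; have {h} h : a x * ad x + N x = 1 by rewrite h eqxx.
by rewrite -h addrK.
Qed.

Lemma double_eq0 X : X = - X -> X = 0.
Proof.
move/eqP; rewrite -addr_eq0 -mulr2n -scaler_nat scaler_eq0 pnatr_eq0 /=.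
by move/eqP.
Qed.

Lemma a_sqr x : a x * a x = 0.
Proof. by apply: double_eq0; exact: anticomm_aa. Qed.

Lemma ad_sqr x : ad x * ad x = 0.
Proof. by apply: double_eq0; exact: anticomm_dd. Qed.

Lemma a_N x : a x * N x = a x.
Proof. by rewrite /number_op mulrA a_ad mulrBl mul1r /number_op -mulrA a_sqr mulr0 subr0. Qed.

Lemma N_a x : N x * a x = 0.
Proof. by rewrite /number_op -mulrA a_sqr mulr0. Qed.

Lemma ad_N x : ad x * N x = 0.
Proof. by rewrite /number_op mulrA ad_sqr mul0r. Qed.

Lemma N_ad x : N x * ad x = ad x.
Proof. by rewrite /number_op -mulrA a_ad mulrBr mulr1 ad_N subr0. Qed.

Lemma N_idem x : N x * N x = N x.
Proof. by rewrite {2 3}/number_op mulrA N_ad. Qed.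

Lemma N_herm x : (N x)^t* = N x.
Proof. by rewrite /number_op trCM trmxCK. Qed.

Lemma comm_N_a x y : x != y -> GRing.comm (N x) (a y).
Proof.
move=> xy; rewrite /GRing.comm /number_op -mulrA anticomm_aa mulrN mulrA.
by rewrite -[ad x * a y]opprK -anticomm_ad 1?eq_sym // mulNr opprK -mulrA.
Qed.

Lemma comm_N_ad x y : x != y -> GRing.comm (N x) (ad y).
Proof.
move=> xy; rewrite /GRing.comm -[N x]N_herm -!trCM.
by rewrite (comm_N_a xy).
Qed.

Lemma comm_NN x y : GRing.comm (N x) (N y).
Proof.
have [->|xy] := eqVneq x y; first exact: commr_refl.
by rewrite {2}/number_op; apply: commrM; [exact: comm_N_ad | exact: comm_N_a].
Qed.

(** The relation a^* a + a a^* = 1 as a quadratic form; it makes both operators contractions at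
    once. *)
Lemma nsq_a_ad x v : nsq (a x *m v) + nsq (ad x *m v) = nsq v.
Proof.
rewrite /nsq -cReD !dot_adj trmxCK -dotDl; congr (Re (dot _ _)).
rewrite !mulmxA -mulmxDl -[_ + _]/(N x + a x * ad x) a_ad addrC subrK.
exact: mul1mx.
Qed.

Definition contr X := forall v, nrm (X *m v) <= nrm v.

Lemma contr_nsq X : (forall v, nsq (X *m v) <= nsq v) -> contr X.
Proof. by move=> h v; rewrite ler_wsqrtr. Qed.

Lemma contr_a x : contr (a x).
Proof. by apply: contr_nsq => v; rewrite -(nsq_a_ad x v) lerDl nsq_ge0. Qed.

Lemma contr_ad x : contr (ad x).
Proof. by apply: contr_nsq => v; rewrite -(nsq_a_ad x v) lerDr nsq_ge0. Qed.

Lemma contrM X Y : contr X -> contr Y -> contr (X * Y).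
Proof. by move=> h1 h2 v; rewrite -mulmxA; apply: le_trans (h1 _) (h2 _). Qed.

Lemma contr_N x : contr (N x).
Proof. by apply: contrM; [exact: contr_ad | exact: contr_a]. Qed.

Lemma contr_prod (s : seq M) (F : M -> A) : (forall x, contr (F x)) ->
  contr (\prod_(x <- s) F x).
Proof.
move=> h; elim/big_rec: _ => [v|x X _ hX]; first by rewrite mul1mx.
exact: (contrM (h x) hX).
Qed.

(** Used with c = -1: the signs multiply along a product, so an even number of anticommuting factors
    commutes. *)
Definition qcomm (c : C) Z X := Z * X = c *: (X * Z).

Lemma qcommM c d Z X Y : qcomm c Z X -> qcomm d Z Y -> qcomm (c * d) Z (X * Y).
Proof.
rewrite /qcomm => h1 h2; rewrite mulrA h1 -scalerAl -[X * Z * Y]mulrA h2.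
by rewrite -scalerAr scalerA mulrA.
Qed.

Lemma qcomm_prod c Z (s : seq M) (F : M -> A) :
  (forall x, x \in s -> qcomm c Z (F x)) ->
  qcomm (c ^+ size s) Z (\prod_(x <- s) F x).
Proof.
elim: s => [|x s ih] h.
  by rewrite big_nil expr0 /qcomm mul1r mulr1 scale1r.
rewrite big_cons exprS; apply: qcommM; first by apply: h; rewrite mem_head.
by apply: ih => y hy; apply: h; rewrite inE hy orbT.
Qed.

Lemma qcomm1 Z X : qcomm 1 Z X <-> GRing.comm Z X.
Proof. by rewrite /qcomm scale1r. Qed.

Lemma qcommN1 Z X : Z * X = - (X * Z) -> qcomm (-1) Z X.
Proof. by move=> h; rewrite /qcomm h scaleN1r. Qed.

(** [d] is the change of particle number caused by [X]; weights add under products and weight 0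
    means conservation. *)
Definition weight (d : C) X := Ntot * X = X * Ntot + d *: X.

Lemma weightM c d X Y : weight c X -> weight d Y -> weight (c + d) (X * Y).
Proof.
rewrite /weight => h1 h2; rewrite mulrA h1 mulrDl -[X * _ * Y]mulrA h2 mulrDr scalerDl.
by rewrite -scalerAl -scalerAr mulrA -addrA [d *: _ + _]addrC.
Qed.

Lemma weight_prod d (s : seq M) (F : M -> A) : (forall x, weight d (F x)) ->
  weight (d *+ size s) (\prod_(x <- s) F x).
Proof.
move=> h; elim: s => [|x s ih].
  by rewrite big_nil /weight mulr1 mul1r scale0r addr0.
by rewrite big_cons mulrS; apply: weightM.
Qed.

Lemma comm_Nrest_a y : GRing.comm (a y) (Ntot - N y).
Proof.
rewrite (bigD1 y) //= addrAC subrr add0r; apply: commr_sum => x xy.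
by apply/commr_sym/comm_N_a.
Qed.

(** Only the summand [N y] of the total number fails to commute with [a y], and there N a = 0 while
    a N = a. *)
Lemma weight_a y : weight (-1) (a y).
Proof.
rewrite /weight -(subrK (N y) Ntot) mulrDl mulrDr N_a a_N addr0.
by rewrite (comm_Nrest_a y) scaleN1r addrK.
Qed.

Lemma Ntot_herm : Ntot^t* = Ntot.
Proof.
by rewrite trC_sum; apply: eq_bigr => x _; exact: N_herm.
Qed.

Lemma weight_ad y : weight 1 (ad y).
Proof.
have := congr1 (fun X : A => X^t*) (weight_a y).
rewrite scaleN1r trCB !trCM Ntot_herm /weight scale1r => ->.
by rewrite subrK.
Qed.

Lemma weight0 X : weight 0 X <-> GRing.comm Ntot X.
Proof. by rewrite /weight scale0r addr0. Qed.

Lemma comm_Ntot_N y : GRing.comm Ntot (N y).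
Proof. by apply/commr_sym/commr_sum => x _; exact: comm_NN. Qed.

(** * A single number-preserving term *)

Section Monomial.
Variables (hc : bool) (m k : nat) (s : k.-tuple M).
Hypothesis hm : (m.*2 <= k)%N.

Let hmk : (m <= k)%N.
Proof. by apply: leq_trans hm; rewrite -addnn leq_addr. Qed.

Let sz1 : size (take m s) = m.
Proof. by rewrite size_takel // size_tuple. Qed.

Let sz2 : size (take m (drop m s)) = m.
Proof. by rewrite size_takel // size_drop size_tuple leq_subRL // addnn. Qed.

Let sub1 x : x \in take m s -> x \in s. Proof. exact: mem_take. Qed.
Let sub2 x : x \in take m (drop m s) -> x \in s.
Proof. by move/mem_take/mem_drop. Qed.
Let sub3 x : x \in drop m.*2 s -> x \in s. Proof. exact: mem_drop. Qed.

Lemma comm_Ntot_npfo : GRing.comm Ntot (npfo a m s).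
Proof.
apply: commrM; last first.
  by apply: commr_prod => x _; exact: comm_Ntot_N.
apply/weight0.
have := weightM (weight_prod (take m s) weight_ad) (weight_prod (take m (drop m s)) weight_a).
by rewrite sz1 sz2 mulNrn subrr.
Qed.

Lemma comm_npfo_out Z : (forall x, x \in s -> Z * a x = - (a x * Z)) ->
  (forall x, x \in s -> Z * ad x = - (ad x * Z)) -> GRing.comm Z (npfo a m s).
Proof.
move=> h1 h2; apply: commrM; last first.
  rewrite big_seq; apply: commr_prod => x /sub3 hx.
  rewrite /number_op /GRing.comm mulrA h2 // mulNr -mulrA h1 // mulrN opprK mulrA.
  by [].
apply/qcomm1; have -> : (1 : C) = (-1) ^+ m * (-1) ^+ m.
  by rewrite -exprMn mulrNN mulr1 expr1n.
have q1 := @qcomm_prod (-1) Z (take m s) (fun x => ad x) (fun x hx => qcommN1 (h2 x (sub1 hx))).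
have q2 := @qcomm_prod (-1) Z (take m (drop m s)) a (fun x hx => qcommN1 (h1 x (sub2 hx))).
by rewrite sz1 in q1; rewrite sz2 in q2; exact: qcommM.
Qed.

Lemma comm_npfo_in Z : (forall x, x \in s -> GRing.comm Z (a x) /\ GRing.comm Z (ad x)) ->
  GRing.comm Z (npfo a m s).
Proof.
move=> h; apply: commrM; first apply: commrM; rewrite big_seq; apply: commr_prod => x.
- by move=> /sub1 /h [].
- by move=> /sub2 /h [].
by move=> /sub3 /h [h1 h2]; apply: commrM.
Qed.

Lemma contr_npfo : contr (npfo a m s).
Proof.
apply: contrM; first apply: contrM; apply: contr_prod.
- exact: contr_ad.
- exact: contr_a.
exact: contr_N.
Qed.

Definition vac (S : {pred M}) v := forall x, x \in S -> a x *m v = 0.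

Lemma prod_vac (r : seq M) (F : M -> A) v : r != [::] ->
  (forall x, x \in r -> F x *m v = 0) -> \prod_(x <- r) F x *m v = 0.
Proof.
case/lastP: r => // r x _ h; rewrite -cats1 big_cat big_seq1.
rewrite -[_ *m v]/((\prod_(y <- r) F y *m F x) *m v) -mulmxA h ?mulmx0 //.
by rewrite mem_rcons mem_head.
Qed.

Lemma vac_N (S : {pred M}) x v : vac S v -> x \in S -> N x *m v = 0.
Proof. by move=> hv hx; rewrite -mulmxA hv // mulmx0. Qed.

(** The rightmost factor annihilates [v]: a number operator if there is one, otherwise an
    annihilation operator, since then k > 0 forces m > 0. *)
Lemma npfo_vac v : (0 < k)%N -> vac [in s] v -> npfo a m s *m v = 0.
Proof.
move=> k0 hv; rewrite /npfo -mulmxA.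
have [e|ne] := eqVneq (drop m.*2 s) [::].
  rewrite e big_nil mul1mx -mulmxA prod_vac ?mulmx0 // => [|x /sub2 hx]; last exact: hv.
  rewrite -size_eq0 sz2; apply/negP => /eqP m0.
  have := congr1 size e; rewrite size_drop size_tuple m0 subn0 /=.
  by move=> k00; rewrite k00 in k0.
by rewrite prod_vac ?mulmx0 // => x /sub3 hx; exact: vac_N hv hx.
Qed.

Lemma prod_adj (r : seq M) (F : M -> A) :
  (\prod_(x <- r) F x)^t* = \prod_(x <- rev r) (F x)^t*.
Proof.
elim: r => [|x r ih]; first by rewrite !big_nil trC1.
by rewrite big_cons trCM ih rev_cons -cats1 big_cat big_seq1.
Qed.

Lemma npfo_adj_vac v : (0 < k)%N -> vac [in s] v -> (npfo a m s)^t* *m v = 0.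
Proof.
move=> k0 hv; rewrite /npfo !trCM !prod_adj !mulv.
(* In the adjoint the creation operators become annihilation operators acting first; if m = 0 only
   number operators are present. *)
have [m0|m0] := posnP m.
  rewrite m0 !take0 /= !big_nil !mul1mx prod_vac // => [|x].
    by rewrite -size_eq0 size_rev size_drop size_tuple double0 subn0 -lt0n.
  by rewrite mem_rev N_herm => /mem_drop hx; exact: vac_N hv hx.
rewrite (prod_vac (r := rev (take m s))) ?mulmx0 // => [|x].
  by rewrite -size_eq0 size_rev sz1 -lt0n.
by rewrite mem_rev trmxCK => /sub1 hx; exact: hv.
Qed.

Local Notation h := (npfo_term a hc m s).

Lemma comm_adj Z X : GRing.comm (Z^t*) X -> GRing.comm Z (X^t*).
Proof. by move=> e; rewrite /GRing.comm -[Z]trmxCK -!trCM e. Qed.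

Lemma comm_Ntot_term : GRing.comm Ntot h.
Proof.
rewrite /npfo_term; case: hc; last exact: comm_Ntot_npfo.
apply: commrD; first exact: comm_Ntot_npfo.
by apply: comm_adj; rewrite Ntot_herm; exact: comm_Ntot_npfo.
Qed.

Lemma comm_term_out x : x \notin s -> GRing.comm (a x) h /\ GRing.comm (ad x) h.
Proof.
move=> hx.
have ne y : y \in s -> x != y by move=> hy; apply: contraNneq hx => ->.
have h1 : GRing.comm (a x) (npfo a m s).
  apply: comm_npfo_out => y hy; first exact: anticomm_aa.
  exact/anticomm_ad/ne.
have h2 : GRing.comm (ad x) (npfo a m s).
  apply: comm_npfo_out => y hy; last exact: anticomm_dd.
  by rewrite anticomm_ad ?opprK // eq_sym ne.
rewrite /npfo_term; case: hc; split=> //; apply: commrD => //; apply: comm_adj => //.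
by rewrite trmxCK.
Qed.

Lemma comm_term_in Z : (forall x, x \in s -> GRing.comm Z (a x) /\ GRing.comm Z (ad x)) ->
  GRing.comm Z h.
Proof.
move=> hZ; rewrite /npfo_term; case: hc; last exact: comm_npfo_in.
apply: commrD; first exact: comm_npfo_in.
apply: comm_adj; apply: comm_npfo_in => x /hZ [h1 h2]; split.
  by have := comm_adj (Z := (Z^t*)) (X := ad x); rewrite !trmxCK; apply.
by apply: comm_adj; rewrite trmxCK.
Qed.

Lemma contr_adj X : contr X -> contr (X^t*).
Proof.
move=> hX v; set w := X^t* *m v.
have [->|w0] := eqVneq (nrm w) 0; first exact: nrm_ge0.
have w1 : 0 < nrm w by rewrite lt_def w0 nrm_ge0.
rewrite -(ler_pM2l w1) -expr2 nrm_sqr.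
have -> : nsq w = Re (dot v (X *m w)) by rewrite dot_adj.
by apply: le_trans (CS_Re _ _) _; rewrite mulrC ler_wpM2r ?nrm_ge0.
Qed.

Lemma term_bound v : nrm (h *m v) <= 2 * nrm v.
Proof.
rewrite /npfo_term; case: hc; last first.
  by apply: le_trans (contr_npfo _) _; rewrite ler_peMl ?nrm_ge0 // ler1n.
rewrite mulmxDl mulr2n mulrDl mul1r; apply: le_trans (nrmD _ _) _.
by apply: lerD; [exact: contr_npfo | exact/contr_adj/contr_npfo].
Qed.

Lemma term_vac v : (0 < k)%N -> vac [in s] v -> h *m v = 0 /\ h^t* *m v = 0.
Proof.
move=> k0 hv; have h1 := npfo_vac k0 hv; have h2 := npfo_adj_vac k0 hv.
rewrite /npfo_term; case: hc => //.
by rewrite trCD trmxCK !mulmxDl h1 h2 addr0.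
Qed.

End Monomial.

End LocalOperators.

(** * Sums of local terms and their commutators *)

Section LocalSums.
Variables (R : realType) (n : nat) (M : finType).
Local Notation C := R[i].
Local Notation Re := (@complex.Re R).
Local Notation A := 'M[C]_n.+1.
Variable (a : M -> A).
Hypothesis car : CAR a.
Implicit Types (X Y Z P : A) (v w : 'cV[C]_n.+1) (x y : M) (S : {set M}).

Local Notation ad x := ((a x)^t*).
Local Notation N x := (number_op a x).
Local Notation Ntot := (\sum_(x : M) number_op a x).

(* The projector is P = \prod_(x <- r) (1 - N x), and 1 - P <= \sum_(x <- r) N x. *)
Lemma vac_projector (r : seq M) : exists P : A,
  [/\ P^t* = P, P * P = P, forall y, GRing.comm P (N y),
      forall y, y \in r -> a y * P = 0 &
      forall v, nsq (v - P *m v) <= \sum_(x <- r) nsq (a x *m v)].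
Proof.
elim: r => [|x r [P [herm idem hN hr hv]]].
  exists 1; split=> [||y|y|v] //.
  - exact: trC1.
  - by rewrite mulr1.
  - exact/commr_sym/commr1.
  - by rewrite big_nil mul1mx subrr nsqE big1 // => i _; rewrite mxE ComplexField.Normc.normc0 expr0n.
have aN : a x * (1 - N x) = 0 by rewrite mulrBr mulr1 a_N // subrr.
have cN : GRing.comm P (1 - N x) by apply: commrB (hN x); exact: commr1.
exists (P * (1 - N x)); split.
- by rewrite trCM herm trCB trC1 N_herm cN.
- rewrite {2}cN mulrA -[P * _ * _]mulrA.
  have -> : (1 - N x) * (1 - N x) = 1 - N x.
    by rewrite mulrBr mulr1 mulrBl mul1r N_idem // subrr subr0.
  by rewrite -mulrA -cN mulrA idem.
- move=> y; apply/commr_sym; apply: commrM; first exact/commr_sym/hN.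
  by apply: commrB; [exact: commr1 | exact: comm_NN].
- move=> y; rewrite inE => /orP[/eqP ->|/hr h]; last by rewrite mulrA h mul0r.
  by rewrite cN mulrA aN mul0r.
move=> v; rewrite big_cons [leRHS]addrC.
rewrite (_ : v - _ = (v - P *m v) + P *m (N x *m v)); last first.
  by rewrite mulrBr mulr1 mulmxBl mulv opprB addrA addrAC.
rewrite nsqD; have -> : dot (v - P *m v) (P *m (N x *m v)) = 0.
  by rewrite dot_adj herm mulmxBr -mulv idem subrr -(scale0r 0) dotZl conjc0 mul0r.
rewrite mulr0 addr0; apply: lerD; first exact: hv.
have PC : forall w, nsq (P *m w) <= nsq w.
  move=> w; rewrite -[in leRHS](subrK (P *m w) w) nsqD.
  have -> : dot (w - P *m w) (P *m w) = 0.
    by rewrite dot_adj herm mulmxBr -mulv idem subrr -(scale0r 0) dotZl conjc0 mul0r.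
  by rewrite mulr0 addr0 lerDr nsq_ge0.
apply: le_trans (PC _) _; by rewrite mulv -[leRHS](nsq_a_ad car x) lerDr nsq_ge0.
Qed.

(* [loc_out] expresses that [Y] is an even operator supported on [S], and [loc_vac] that
   [Y] and its adjoint vanish on states without fermions in [S]. *)
Record loc S (c : R) Y : Prop := Loc {
  loc_comm : GRing.comm Ntot Y;
  loc_out : forall x, x \notin S -> GRing.comm Y (a x) /\ GRing.comm Y (ad x);
  loc_bound : forall v, nrm (Y *m v) <= c * nrm v;
  loc_vac : forall v, vac a [in S] v -> Y *m v = 0 /\ Y^t* *m v = 0 }.

(** The three parameters bound the support size, the number of supports through one mode and the
    norm of one term. The number of terms is left free, so the data are independent of the lattice
    size. *)
Definition local_sum (kappa d : nat) (c : R) Y : Prop :=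
  exists (I : finType) (F : I -> A) (S : I -> {set M}),
    [/\ Y = \sum_i F i, forall i, loc (S i) c (F i), forall i, (#|S i| <= kappa)%N &
        forall x, (\sum_i (x \in S i) <= d)%N].

Lemma sum_nsq_local (I : finType) (S : I -> {set M}) d eta v :
  (forall x, (\sum_i (x \in S i) <= d)%N) -> insec Ntot eta%:R v ->
  \sum_i \sum_(x in S i) nsq (a x *m v) <= d%:R * eta%:R * nsq v.
Proof.
move=> hd hv.
have -> : d%:R * eta%:R * nsq v = \sum_x d%:R * nsq (a x *m v).
  rewrite -mulr_sumr -mulrA; congr (_ * _).
  have : dot v (Ntot *m v) = eta%:R * dot v v by rewrite hv dotZr.
  rewrite mulmx_suml => /(congr1 Re).
  rewrite -(rmorph_nat (real_complex R)) Re_realM /nsq => <-.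
  rewrite -[dot _ _]/((v^t* *m (\sum_x N x *m v)) ord0 ord0) mulmx_sumr summxE Re_sum.
  apply: eq_bigr => x _; rewrite -[_ ord0 ord0]/(dot v (N x *m v)) mulv dot_adj trmxCK.
  by [].
under eq_bigr do rewrite big_mkcond /=.
rewrite exchange_big /=; apply: ler_sum => x _.
have -> : \sum_i (if x \in S i then nsq (a x *m v) else 0) =
    (\sum_i (x \in S i))%:R * nsq (a x *m v).
  rewrite natr_sum mulr_suml; apply: eq_bigr => i _.
  by case: (x \in S i); rewrite ?mul1r ?mul0r.
by rewrite ler_wpM2r ?nsq_ge0 // ler_nat.
Qed.

(* Each summand acts between the components of the two states that have a fermion in its
   support; Cauchy-Schwarz and \sum_i \sum_(x in S i) N x <= d Ntot conclude. *)
Lemma opb_local_sum kappa d c eta Y : 0 <= c -> local_sum kappa d c Y ->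
  opb Ntot eta%:R Y (c * (d%:R * eta%:R)).
Proof.
move=> c0 [I [F [S [-> hF _ hd]]]].
have hN : GRing.comm Ntot (\sum_i F i).
  by apply: commr_sum => i _; exact: loc_comm (hF i).
split=> // v hv; set Z := \sum_i F i; set w := Z *m v.
have hw : insec Ntot eta%:R w by exact: insec_mul.
have [->|w0] := eqVneq (nrm w) 0; first by rewrite !mulr_ge0 ?nrm_ge0.
have [/nrm0_eq0 v0|v0] := eqVneq (nrm v) 0.
  by rewrite /w v0 mulmx0 nrm0 mulr0.
have w1 : 0 < nrm w by rewrite lt_def w0 nrm_ge0.
have v1 : 0 < nrm v by rewrite lt_def v0 nrm_ge0.
have D0 : 0 <= d%:R * eta%:R :> R by rewrite mulr_ge0.
(* The weights |w| and |v| are chosen so that, after summation over the terms, both halves have the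
   same bound d eta |v|^2 |w|^2. This takes the place of Cauchy-Schwarz over the index. *)
have amgm (p q x y : R) : 2 * (p * q) * (x * y) <= q ^+ 2 * x ^+ 2 + p ^+ 2 * y ^+ 2.
  by have := sqr_ge0 (q * x - p * y); lra.
pose nS i u : R := \sum_(x in S i) nsq (a x *m u).
have term i : 2 * (nrm w * nrm v) * Re (dot w (F i *m v)) <=
    c * (nsq v * nS i w + nsq w * nS i v).
  have [P [herm idem _ hr hP]] := vac_projector (enum (S i)).
  have hP' u : nsq (u - P *m u) <= nS i u.
    by apply: le_trans (hP u) _; rewrite /nS big_enum.
  have hvac u : vac a [in S i] (P *m u).
    by move=> x hx; rewrite -mulv hr ?mul0mx // mem_enum.
  have eF : dot w (F i *m v) = dot (w - P *m w) (F i *m (v - P *m v)).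
    have [_ e1] := loc_vac (hF i) (hvac w); have [e2 _] := loc_vac (hF i) (hvac v).
    rewrite mulmxBr e2 subr0 !dot_adj mulmxBr e1 subr0.
    by [].
  rewrite eF.
  have h1 : Re (dot (w - P *m w) (F i *m (v - P *m v))) <=
      c * (nrm (w - P *m w) * nrm (v - P *m v)).
    apply: le_trans (CS_Re _ _) _; rewrite mulrCA ler_wpM2l ?nrm_ge0 //.
    exact: loc_bound (hF i) _.
  apply: le_trans (ler_wpM2l _ h1) _; first by rewrite !mulr_ge0 ?nrm_ge0.
  rewrite mulrCA ler_wpM2l //.
  apply: (@le_trans _ _ (nsq v * nsq (w - P *m w) + nsq w * nsq (v - P *m v))); last first.
    by apply: lerD; rewrite ler_wpM2l ?nsq_ge0.
  rewrite -!nrm_sqr; set x1 := nrm (w - _); set x2 := nrm (v - _).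
  exact: amgm.
have hsum : 2 * (nrm w * nrm v) * nsq w <= c * (2 * (d%:R * eta%:R) * nsq v * nsq w).
  have eW : nsq w = \sum_i Re (dot w (F i *m v)).
    rewrite /nsq {2}/w /Z mulmx_suml -Re_sum; congr Re.
    rewrite /dot mulmx_sumr summxE; exact: eq_bigr.
  rewrite [X in _ * X <= _]eW mulr_sumr; apply: le_trans (ler_sum _ (fun i _ => term i)) _.
  rewrite -mulr_sumr ler_wpM2l // big_split /= -!mulr_sumr.
  have h1 := sum_nsq_local hd hv; have h2 := sum_nsq_local hd hw.
  have h3 := ler_wpM2l (nsq_ge0 w) h1; have h4 := ler_wpM2l (nsq_ge0 v) h2.
  apply: le_trans (lerD h4 h3) _.
  have e (x y D : R) : x * (D * y) + y * (D * x) <= 2 * D * x * y by lra.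
  exact: e.
rewrite -!nrm_sqr in hsum.
have z1 : 0 < 2 * nrm w ^+ 2 * nrm v by rewrite !mulr_gt0.
rewrite -(ler_pM2l z1).
have -> : 2 * nrm w ^+ 2 * nrm v * nrm w = 2 * (nrm w * nrm v) * nrm w ^+ 2 by ring.
by apply: le_trans hsum _; rewrite le_eqVlt; apply/orP; left; apply/eqP; ring.
Qed.

Section Layer.
Variables (hc : bool) (m k : nat) (F : {set k.-tuple M}).
Hypotheses (hm : (m.*2 <= k)%N) (hF : disjoint_supports F).

Let supp (s : k.-tuple M) : {set M} := [set x in s].

Lemma card_supp s : (#|supp s| <= k)%N.
Proof. by rewrite cardsE -[leqRHS](size_tuple s) card_size. Qed.

Lemma overlap_le1 x : (\sum_(s in F) (x \in s) <= 1)%N.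
Proof.
have [/exists_inP[s0 s0F xs0]|/exists_inPn no] := boolP [exists s in F, x \in s]; last first.
  by rewrite big1 // => s sF; rewrite (negbTE (no s sF)).
rewrite (bigD1 s0) //= xs0 big1 ?addn0 // => s /andP[sF ne].
case: (boolP (x \in s)) => // xs.
have /hasPn/(_ x xs) := hF s0F sF (fun e => negP ne (introT eqP (esym e))).
by rewrite /= xs0.
Qed.

Lemma local_sum_layer z : (0 < k)%N ->
  local_sum k 1 (normc z * 2) (z *: \sum_(s in F) npfo_term a hc m s).
Proof.
(* All tuples serve as indices; those outside [F] get the zero operator and an empty support, which
   adds nothing to the overlap count. *)
move=> k0; exists {: k.-tuple M}.
exists (fun s => if s \in F then z *: npfo_term a hc m s else 0).
exists (fun s => if s \in F then supp s else finset.set0); split.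
- by rewrite -big_mkcond scaler_sumr.
- move=> s; case: ifP => sF; split.
  + by apply: commrZ; exact: comm_Ntot_term.
  + move=> x; rewrite inE => xs; have [h1 h2] := comm_term_out car hc hm xs.
    by split; apply/commr_sym/commrZ.
  + move=> v; rewrite -scalemxAl nrmZ -mulrA ler_wpM2l ?normc_ge0 //.
    exact: term_bound.
  + move=> v hv; have [|h1 h2] := @term_vac _ _ _ a hc m k s hm v k0.
      by move=> x xs; apply: hv; rewrite !inE.
    by rewrite -scalemxAl h1 trCZ -scalemxAl h2 !scaler0.
  + exact: commr0.
  + by move=> x _; split; apply/commr_sym/commr0.
  + by move=> v; rewrite mul0mx nrm0 !mulr_ge0 ?normc_ge0 ?nrm_ge0.
  by move=> v _; rewrite trC0 !mul0mx.
- by move=> s; case: ifP => _; rewrite ?cards0 // card_supp.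
move=> x; apply: leq_trans (overlap_le1 x); rewrite [leqRHS]big_mkcond.
apply: leq_sum => s _; case: (s \in F) => //=; by rewrite !inE.
Qed.

Lemma meet_le (S T : {set M}) : (~~ [disjoint S & T] <= \sum_(y in S) (y \in T))%N.
Proof.
case: (boolP [disjoint S & T]) => //= /pred0Pn [y /andP[yS yT]].
by rewrite (bigD1 y) //= [y \in T]yT.
Qed.

(** Each mode of [S] lies in at most one support of the layer. This is how disjointness keeps the
    growth under commutators independent of the lattice. *)
Lemma count_meeting (S : {set M}) :
  (\sum_(s in F) ~~ [disjoint S & supp s] <= #|S|)%N.
Proof.
apply: (@leq_trans (\sum_(s in F) \sum_(y in S) (y \in supp s))%N).
  by apply: leq_sum => s _; exact: meet_le.
rewrite exchange_big -sum1_card; apply: leq_sum => y _.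
by apply: leq_trans (overlap_le1 y); apply: leq_sum => s _; rewrite inE.
Qed.

Lemma brk_sum (I J : finType) (Q : pred J) (f : J -> A) (g : I -> A) :
  brk (\sum_(j | Q j) f j) (\sum_i g i) = \sum_i \sum_(j | Q j) brk (f j) (g i).
Proof.
rewrite exchange_big /= /brk mulr_suml mulr_sumr -sumrB; apply: eq_bigr => j _.
by rewrite mulr_sumr mulr_suml -sumrB.
Qed.

(** Terms with disjoint supports commute, because they are even, so only overlapping pairs survive.
    Their supports unite, and the two products in a bracket have norm at most 2c each. *)
Lemma local_sum_brk z kappa d c Y : 0 <= c -> local_sum kappa d c Y ->
  local_sum (kappa + k) (d * (kappa + k)) (4 * normc z * c)
    (brk (z *: \sum_(s in F) npfo_term a hc m s) Y).
Proof.
move=> c0 [I [G [S [-> hG hS hd]]]].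
have four (x y u w r : R) : x <= 2 * u -> u <= c * r -> y <= c * w ->
    c * w <= c * (2 * r) -> x + y <= 4 * (c * r) by move=> *; lra.
pose ok (q : I * k.-tuple M) := (q.2 \in F) && ~~ [disjoint S q.1 & supp q.2].
exists (I * k.-tuple M)%type.
exists (fun q => if ok q then z *: brk (npfo_term a hc m q.2) (G q.1) else 0).
exists (fun q => if ok q then S q.1 :|: supp q.2 else finset.set0); split.
- rewrite brkZl brk_sum scaler_sumr -(pair_bigA _ (fun i s => if ok (i, s) then
    z *: brk (npfo_term a hc m s) (G i) else 0)) /=; apply: eq_bigr => i _.
  rewrite scaler_sumr big_mkcond; apply: eq_bigr => s _; rewrite /ok /=.
  case: (s \in F) => //=; case: (boolP [disjoint _ & _]) => //= dj.
  rewrite /brk (@comm_term_in _ _ _ a hc m k s (G i)) ?subrr ?scaler0 // => x xs.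
  apply: (loc_out (hG i)); rewrite (disjointFl dj) //.
  by rewrite inE.
- move=> [i s]; rewrite /ok /=; case: ifP => [/andP[sF ndj]|_]; last first.
    split.
    + exact: commr0.
    + by move=> x _; split; apply/commr_sym/commr0.
    + by move=> v; rewrite mul0mx nrm0 !mulr_ge0 ?normc_ge0 ?nrm_ge0.
    by move=> v _; rewrite trC0 !mul0mx.
  set h := npfo_term a hc m s; have hGi := hG i.
  split.
  + apply: commrZ; have h1 := comm_Ntot_term car hc s hm; have h2 := loc_comm hGi.
    by apply: commrB; apply: commrM.
  + move=> x; rewrite !inE negb_or => /andP[xS xs].
    have [h1 h2] := comm_term_out car hc hm xs; have [h3 h4] := loc_out hGi xS.
    split; apply/commr_sym/commrZ; apply: commrB; apply: commrM => //; exact/commr_sym.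
  + move=> v; rewrite -scalemxAl nrmZ.
    have b1 : nrm (brk h (G i) *m v) <= 4 * (c * nrm v).
      rewrite /brk mulmxBl !mulv.
      apply: le_trans (nrmD _ _) _; rewrite nrmN.
      have e1 := term_bound car hc m s (G i *m v); have e2 := loc_bound hGi v.
      have e3 := loc_bound hGi (h *m v).
      have e4 := ler_wpM2l c0 (term_bound car hc m s v).
      exact: four e1 e2 e3 e4.
    by rewrite (_ : 4 * normc z * c * nrm v = normc z * (4 * (c * nrm v))) ?ler_wpM2l ?normc_ge0 //; ring.
  move=> v hv.
  (* The two supports overlap, so the tuple is nonempty and its term kills the local vacuum. *)
  have k0 : (0 < k)%N.
    move: ndj; case/pred0Pn => x /andP[_]; rewrite /= inE => xs.
    by rewrite -(size_tuple s) -has_predT; apply/hasP; exists x.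
  have [|h1 h2] := @term_vac _ _ _ a hc m k s hm v k0.
    by move=> x xs; apply: hv; rewrite !inE xs orbT.
  have [|h3 h4] := loc_vac hGi (v := v).
    by move=> x xs; apply: hv; rewrite !inE xs.
  rewrite -/h in h1 h2.
  rewrite trCZ -!scalemxAl /brk trCB !trCM !mulmxBl !mulv h1 h2 h3 h4 !mulmx0 subrr.
  by rewrite !scaler0.
- move=> q; case: ifP => _; rewrite ?cards0 //.
  by apply: leq_trans (leq_card_setU _ _) _; rewrite leq_add ?hS ?card_supp.
move=> x.
(* If x is in [S i], there are at most d such i and at most kappa tuples meeting each. If x is in s,
   there is at most one such s, and at most k d sets [S i] meet it. *)
apply: (@leq_trans (\sum_i \sum_(s in F) (~~ [disjoint S i & supp s]) * (x \in S i) +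
                    \sum_i \sum_(s in F) (~~ [disjoint S i & supp s]) * (x \in s))%N).
  rewrite -big_split /= -(pair_bigA _ (fun i s => (x \in if ok (i, s) then S i :|: supp s
    else finset.set0) : nat)) /=; apply: leq_sum => i _.
  rewrite -big_split /= [leqRHS]big_mkcond; apply: leq_sum => s _.
  rewrite /ok /=; case: (s \in F); last by rewrite inE.
  case: [disjoint _ & _] => /=; first by rewrite inE.
  by rewrite !inE !mul1n; case: (x \in S i); case: (x \in s).
rewrite mulnDr; apply: leq_add.
  apply: (@leq_trans (\sum_i kappa * (x \in S i))%N); last first.
    by rewrite -big_distrr /= mulnC leq_mul2r hd orbT.
  apply: leq_sum => i _; rewrite -big_distrl /= leq_mul2r.
  by rewrite (leq_trans (count_meeting _) (hS i)) orbT.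
rewrite exchange_big /=.
apply: (@leq_trans (\sum_(s in F) (x \in s) * (k * d))%N); last first.
  by rewrite -big_distrl /= mulnC [(d * k)%N]mulnC -[leqRHS]muln1 leq_mul2l overlap_le1 orbT.
apply: leq_sum => s _; rewrite -big_distrl /= mulnC leq_mul2l; apply/orP; right.
apply: (@leq_trans (\sum_i \sum_(y in supp s) (y \in S i))%N).
  by apply: leq_sum => i _; rewrite disjoint_sym; exact: meet_le.
rewrite exchange_big /=; apply: (@leq_trans (\sum_(y in supp s) d)%N).
  by apply: leq_sum => y _; exact: hd.
by rewrite sum_nat_const leq_mul2r card_supp orbT.
Qed.

End Layer.

End LocalSums.

(** * Suzuki's formulae as lists of exponentials *)

Lemma suzuki_mulE (A : pzRingType) (x y : A) :
  x ^+ 2 * y * x ^+ 2 = x * (x * (y * (x * x))).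
Proof. by rewrite !expr2 !mulrA. Qed.

Section FormulaLists.
Variable (R : realType).
Local Notation C := R[i].

Definition rescale (T : Type) (c : R) (l : seq (R * T)) : seq (R * T) :=
  [seq (c * x.1, x.2) | x <- l].

Definition pf1_list G : seq (R * 'I_G) := [seq (1, g) | g <- enum 'I_G].

Definition pf2_list G : seq (R * 'I_G) :=
  [seq (2^-1, g) | g <- enum 'I_G] ++ [seq (2^-1, rev_ord g) | g <- enum 'I_G].

Fixpoint pfeven_list G (n : nat) : seq (R * 'I_G) :=
  if n is n'.+1 then
    let s := suzuki_coef R n'.+1.*2 in
    let l := pfeven_list G n' in
    rescale s l ++ rescale s l ++ rescale (1 - 4 * s) l ++ rescale s l ++ rescale s l
  else pf2_list G.

Definition pf_list G p := if p == 1%N then pf1_list G else pfeven_list G p./2.-1.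

(** With r the m-th root of 4 and s = 1/(4 - r), one has 1 - 4s = - r s, whose m-th power is - 4 s^m
    for odd m. *)
Lemma suzuki_coefP (n : nat) : let s := suzuki_coef R n.+1.*2 in
  4 * s ^+ n.+1.*2.+1 + (1 - 4 * s) ^+ n.+1.*2.+1 = 0.
Proof.
rewrite /suzuki_coef; set m := n.+1.*2.+1; set r := 4 `^ _.
have r0 : 0 <= r := powR_ge0 _ _.
have rm : r ^+ m = 4.
  by rewrite -powR_mulrn // -powRrM mulVf ?pnatr_eq0 // powRr1.
(* If r were 4, then r^m = 4 would force 4^(m-1) = 1. *)
have r4 : 4 - r != 0.
  apply/eqP => /eqP; rewrite subr_eq0 => /eqP e.
  have h : (1 : R) < 4 ^+ n.+1.*2 by rewrite exprn_egt1 // ltr1n.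
  by move: rm; rewrite -e exprS; lra.
have -> : 1 - 4 * (4 - r)^-1 = - r * (4 - r)^-1 by field.
rewrite exprMn exprNn rm -signr_odd /= odd_double /=.
by ring.
Qed.

Variables (n : nat) (G : nat).
Local Notation A := 'M[C]_n.+1.
Variable X : 'I_G -> A.

Definition lift_list (l : seq (R * 'I_G)) : seq A := [seq (x.1)%:C *: X x.2 | x <- l].

Lemma lift_rescale c l : lift_list (rescale c l) = scl c%:C (lift_list l).
Proof.
rewrite /lift_list /scl /rescale -!map_comp; apply: eq_map => x /=.
by rewrite scalerA rmorphM.
Qed.

Lemma lift_cat l1 l2 : lift_list (l1 ++ l2) = lift_list l1 ++ lift_list l2.
Proof. exact: map_cat. Qed.

Lemma rev_enum_ord : rev (enum 'I_G) = [seq rev_ord g | g <- enum 'I_G].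
Proof.
apply: (inj_map val_inj); rewrite map_rev val_enum_ord.
case: G => [|k]; first by rewrite /= -map_comp; case: (enum _) => [//|[]].
apply: (@eq_from_nth _ 0%N) => [|i].
  by rewrite size_rev size_iota size_map size_map size_enum_ord.
rewrite size_rev size_iota => hi.
rewrite nth_rev ?size_iota // nth_iota ?add0n; last by rewrite ltn_subrL.
rewrite -map_comp (nth_map ord0) ?size_enum_ord //=.
by rewrite nth_enum_ord.
Qed.

Lemma pf2_sym : rev (lift_list (pf2_list G)) = lift_list (pf2_list G).
Proof.
rewrite -map_rev; congr (map _ _).
rewrite /pf2_list; move: (enum 'I_G) rev_enum_ord => e he.
rewrite rev_cat -!map_rev he -map_comp; congr (_ ++ _).
  by apply: eq_map => g /=; rewrite rev_ordK.
by rewrite -map_comp.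
Qed.

Lemma lift_sum (l : seq (R * 'I_G)) :
  \sum_(Y <- lift_list l) Y = \sum_(x <- l) (x.1)%:C *: X x.2.
Proof. by rewrite big_map. Qed.

(** The two half sweeps add up to the full sum, which gives order one; the palindrome raises it to
    two. *)
Lemma pf2_order N : (2 < N)%N ->
  eqm 3 (fP N (lift_list (pf2_list G))) (fexp N (\sum_g X g)).
Proof.
case: N => [|[|N]] // hN; apply: symmetric_order => //; first exact: pf2_sym.
have <- : \sum_(Y <- lift_list (pf2_list G)) Y = \sum_g X g; last exact: order_one.
rewrite lift_sum big_cat /= big_map [X in _ + X]big_map /= !big_enum /= -!scaler_sumr.
rewrite [X in _ + _ *: X](reindex_inj rev_ord_inj) /=.
under [X in _ + _ *: X]eq_bigr do rewrite rev_ordK.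
by rewrite -scalerDl -rmorphD /= -mulr2n -[_ *+ 2]mulr_natr mulVf ?scale1r // pnatr_eq0.
Qed.

Lemma pfeven_order N k : (k.+1.*2 < N)%N ->
  rev (lift_list (pfeven_list G k)) = lift_list (pfeven_list G k) /\
  eqm k.+1.*2.+1 (fP N (lift_list (pfeven_list G k))) (fexp N (\sum_g X g)).
Proof.
elim: k => [|k ih] hN; first by split; [exact: pf2_sym | exact: pf2_order].
have [|h1 h2] := ih; first by apply: ltn_trans hN; rewrite doubleS.
have -> : lift_list (pfeven_list G k.+1) =
    suzuki_list (suzuki_coef R k.+1.*2)%:C (lift_list (pfeven_list G k)).
  rewrite /= !lift_cat !lift_rescale /suzuki_list.
  by rewrite rmorphB rmorph1 rmorphM rmorph_nat.
rewrite doubleS; apply: suzuki_order => //.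
- by rewrite /= odd_double.
have := suzuki_coefP k; move=> /(congr1 (real_complex R)).
rewrite rmorphD rmorphM !rmorphXn rmorphB rmorphM rmorph_nat rmorph1 rmorph0.
by [].
Qed.

Lemma pf_order p : product_order p ->
  eqm p.+1 (fP p.+1 (lift_list (pf_list G p))) (fexp p.+1 (\sum_g X g)).
Proof.
move=> hp; rewrite /pf_list; case: eqP => [->|p1].
  have <- : \sum_(Y <- lift_list (pf1_list G)) Y = \sum_g X g; last exact: order_one.
  by rewrite lift_sum big_map /= big_enum /=; apply: eq_bigr => g _; rewrite scale1r.
case: hp => // -[p0 ep].
have e : p = (p./2.-1).+1.*2.
  by rewrite prednK ?half_gt0 ?even_halfK //; case: p p0 ep {p1} => [|[|]].
by rewrite {1 2 4}e; have [] := @pfeven_order p.+1 p./2.-1; rewrite -e.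
Qed.

Lemma prodt_scl c (l : seq A) t : prodt (scl c%:C l) t = prodt l (c * t).
Proof.
rewrite /prodt big_map; apply: eq_bigr => Y _.
by rewrite /mexpt scalerA -rmorphM mulrC.
Qed.

Lemma prodt_cat (l1 l2 : seq A) t : prodt (l1 ++ l2) t = prodt l1 t * prodt l2 t.
Proof. exact: big_cat. Qed.

Lemma prodt_lift (l : seq (R * 'I_G)) t :
  prodt (lift_list l) t = \prod_(x <- l) mexpt ((x.1)%:C *: X x.2) t.
Proof. exact: big_map. Qed.

Lemma prod_ord_enum (F : 'I_G -> A) : \prod_(g < G) F g = \prod_(g <- enum 'I_G) F g.
Proof. by rewrite enumT [index_enum _]unlock. Qed.

Variable H : 'I_G -> A.
Hypothesis XH : forall g, X g = Complex 0 (-1) *: H g.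

Lemma neg_imag (x : R) : Complex 0 (- x) = x%:C * Complex 0 (-1).
Proof. by apply: complex_eq; rewrite ?cReM ?cImM /=; ring. Qed.

Lemma evolE g c t : evol (H g) (c * t) = mexpt (c%:C *: X g) t.
Proof.
rewrite /evol /mexpt XH !scalerA -rmorphM -neg_imag [t * c]mulrC.
by [].
Qed.

Lemma PF1E t : PF1 H t = prodt (lift_list (pf1_list G)) t.
Proof.
rewrite prodt_lift big_map -prod_ord_enum; apply: eq_bigr => g _ /=.
by rewrite -evolE mul1r.
Qed.

Lemma PF2E t : PF2 H t = prodt (lift_list (pf2_list G)) t.
Proof.
rewrite /pf2_list lift_cat prodt_cat !prodt_lift.
by congr (_ * _); rewrite big_map -prod_ord_enum; apply: eq_bigr => g _ /=; rewrite -evolE mulrC.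
Qed.

Lemma PFevenE k t : PFeven H k t = prodt (lift_list (pfeven_list G k)) t.
Proof.
elim: k t => [|k ih] t /=; first exact: PF2E.
rewrite !lift_cat !prodt_cat !lift_rescale !prodt_scl -!ih; exact: suzuki_mulE.
Qed.

Lemma product_formulaE p t : product_formula H p t = prodt (lift_list (pf_list G p)) t.
Proof. by rewrite /product_formula /pf_list; case: ifP => _; [exact: PF1E | exact: PFevenE]. Qed.

End FormulaLists.

(** * The Trotter error of a layered Hamiltonian *)

Section Assembly.
Variable R : realType.
Local Notation C := R[i].
Local Notation Re := (@complex.Re R).

(** Iterates the parameter change of [local_sum_brk] for [r] brackets with layers of strength at
    most [J0] and locality at most [k0], and ends with the factor c d of [opb_local_sum]. *)
Fixpoint nested_cst (J0 : R) (k0 r kappa d : nat) (c : R) : R :=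
  if r is r'.+1 then nested_cst J0 k0 r' (kappa + k0) (d * (kappa + k0)) (4 * J0 * c)
  else c * d%:R.

Lemma nested_cst_ge0 J0 k0 r kappa d c : 0 <= J0 -> 0 <= c ->
  0 <= nested_cst J0 k0 r kappa d c.
Proof.
move=> hJ; elim: r kappa d c => [|r ih] kappa d c hc /=; first by rewrite mulr_ge0.
by apply: ih; rewrite !mulr_ge0.
Qed.

Section Hamiltonian.
Variables (n G : nat) (M : finType) (a : M -> 'M[C]_n.+1).
Variables (J : 'I_G -> R) (k m : 'I_G -> nat) (hc : 'I_G -> bool).
Variable F : forall g : 'I_G, {set (k g).-tuple M}.
Hypotheses (car : CAR a) (hm : forall g, ((m g).*2 <= k g)%N).
Hypothesis hF : forall g, disjoint_supports (F g).
Local Notation A := 'M[C]_n.+1.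
Local Notation Ntot := (\sum_(x : M) number_op a x).
Local Notation H g := (ham_layer a (J g) (hc g) (m g) (F g)).

Definition layer g : A := Complex 0 (-1) *: H g.

Let J0 := \sum_g `|J g|.
Let k0 := (\sum_g k g)%N.

Let le_J0 g : `|J g| <= J0.
Proof. by rewrite /J0 (bigD1 g) //= lerDl sumr_ge0. Qed.

Let le_k0 g : (k g <= k0)%N.
Proof. by rewrite /k0 (bigD1 g) //= leq_addr. Qed.

Let J0_ge0 : 0 <= J0. Proof. exact: sumr_ge0. Qed.

Lemma normcNi : normc (Complex 0 (-1) : C) = 1.
Proof. by rewrite /= expr0n add0r sqrrN expr1n sqrtr1. Qed.

Lemma layerE g : layer g =
  (Complex 0 (-1) * Complex (J g) 0) *: \sum_(s in F g) npfo_term a (hc g) (m g) s.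
Proof. by rewrite /layer /ham_layer scalerA. Qed.

Let normc_layer g : normc (Complex 0 (-1) * Complex (J g) 0) = `|J g|.
Proof. by rewrite ComplexField.Normc.normcM normcNi mul1r normc_real. Qed.

Lemma local_sum_le kappa kappa' d d' c c' (Y : A) :
  (kappa <= kappa')%N -> (d <= d')%N -> c <= c' ->
  local_sum a kappa d c Y -> local_sum a kappa' d' c' Y.
Proof.
move=> h1 h2 h3 [I [f [S [e hf hS hd]]]]; exists I, f, S; split=> //.
- move=> i; have [b1 b2 b3 b4] := hf i; split=> // v.
  by apply: le_trans (b3 v) _; rewrite ler_wpM2r ?nrm_ge0.
- by move=> i; apply: leq_trans (hS i) h1.
by move=> x; apply: leq_trans (hd x) h2.
Qed.

Lemma comm_layer g : GRing.comm Ntot (layer g).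
Proof.
rewrite layerE; apply: commrZ; apply: commr_sum => s _.
exact: comm_Ntot_term.
Qed.

Variable eta : nat.
Local Notation nest := (nest Ntot eta%:R layer).
Local Notation opb := (opb Ntot eta%:R).

Lemma nest_local_sum r kappa d c (Y : A) : 0 <= c -> local_sum a kappa d c Y ->
  nest r Y (nested_cst J0 k0 r kappa d c * eta%:R).
Proof.
elim: r kappa d c Y => [|r ih] kappa d c Y c0 hY /=.
  by rewrite -mulrA; exact: (opb_local_sum car eta c0 hY).
split=> [|g].
  by case: hY => I [f [S [-> hf _ _]]]; apply: commr_sum => i _; exact: loc_comm (hf i).
apply: ih; first by rewrite !mulr_ge0.
rewrite layerE.
have h := local_sum_brk car (hc g) (hm g) (@hF g) (Complex 0 (-1) * Complex (J g) 0) c0 hY.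
apply: local_sum_le _ _ _ h.
- by rewrite leq_add2l.
- by rewrite leq_mul2l leq_add2l le_k0 orbT.
by rewrite normc_layer ler_wpM2r // ler_wpM2l.
Qed.

Lemma local_sum_layers g : (0 < k g)%N -> local_sum a k0 1 (2 * J0) (layer g).
Proof.
move=> kg; rewrite layerE.
have h := local_sum_layer car (hc g) (hm g) (@hF g) (Complex 0 (-1) * Complex (J g) 0) kg.
apply: local_sum_le _ _ _ h => //.
by rewrite normc_layer mulrC ler_wpM2l.
Qed.

(* Layers with [k g = 0] do not vanish on the vacuum, but they are real scalars, which drop
   out of commutators and have unitary exponentials. *)
Lemma layer_scalar g : k g = 0%N -> exists r : R, H g = r%:C *: (1 : A).
Proof.
move=> kg.
have hterm (s : (k g).-tuple M) : npfo_term a (hc g) (m g) s = (if hc g then 2 else 1) *: 1.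
  have s0 : tval s = [::] by apply: size0nil; rewrite size_tuple.
  have e : npfo a (m g) s = 1 by rewrite /npfo s0 /= !big_nil !mulr1.
  by rewrite /npfo_term e trC1; case: (hc g); rewrite ?scale1r // scaler_nat mulr2n.
exists (J g * ((if hc g then 2 else 1) *+ #|F g|)).
rewrite /ham_layer (eq_bigr _ (fun s _ => hterm s)) sumr_const scalerMnl scalerA rmorphM.
by rewrite rmorphMn; case: (hc g); rewrite /= ?rmorph1 ?rmorph_nat.
Qed.

Lemma nest_scalar r (z : C) : (0 < r)%N -> nest r (z *: 1) 0.
Proof.
case: r => // r _; split=> [|g]; first by apply: commrZ; exact: commr1.
rewrite brkZr /brk mulr1 mul1r subrr scaler0; exact: nest0.
Qed.

Lemma nest_layer p g : (0 < p)%N ->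
  nest p (layer g) (nested_cst J0 k0 p k0 1 (2 * J0) * eta%:R).
Proof.
move=> p0; have c0 : 0 <= 2 * J0 by rewrite mulr_ge0.
have [kg|kg] := posnP (k g); last exact: nest_local_sum c0 (local_sum_layers kg).
have [r e] := layer_scalar kg; rewrite /layer e scalerA.
by apply: nest_le (nest_scalar _ p0); rewrite mulr_ge0 ?nested_cst_ge0.
Qed.

Lemma Re_dot_herm (X : A) v : X^t* = X -> Re (dot v ((Complex 0 (-1) *: X) *m v)) = 0.
Proof.
move=> hX; rewrite -scalemxAl dotZr.
have e : dot v (X *m v) = dot (X *m v) v by rewrite dot_adj hX.
have := congr1 (@complex.Im R) (dotC v (X *m v)); rewrite e cReM.
by case: (dot (X *m v) v) => x y /=; lra.
Qed.

(* [b = 0] for Hermitian layers; otherwise [b] is the O(eta) bound on the layers, and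
   t eta <= 1 keeps [b * t] bounded. *)
Lemma energy_bound (t : R) : 0 <= t ->
  (forall g, H g \is hermsymmx) \/ t * eta%:R <= 1 ->
  exists b : R, [/\ 0 <= b, b * t <= 2 * J0 &
    forall g v, insec Ntot eta%:R v -> `|Re (dot v (layer g *m v))| <= b * nsq v].
Proof.
move=> t0 [hH|ht].
  exists 0; split; rewrite ?mul0r ?mulr_ge0 // => g v _.
  rewrite Re_dot_herm ?normr0 // ?mul0r //.
  by have /is_hermitianmxP := hH g; rewrite expr0 scale1r => <-.
have hb : 0 <= 2 * J0 * eta%:R by rewrite !mulr_ge0.
exists (2 * J0 * eta%:R); split=> //.
  by rewrite -[leLHS]mulrA ler_piMr ?mulr_ge0 // mulrC.
move=> g v hv; have [kg|kg] := posnP (k g).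
  have [r e] := layer_scalar kg.
  rewrite /layer e Re_dot_herm ?normr0 ?mulr_ge0 ?nsq_ge0 //.
  by rewrite trCZ trC1 conjc_real.
have c0 : 0 <= 2 * J0 by rewrite mulr_ge0.
have [_ h] := opb_local_sum car eta c0 (local_sum_layers kg).
apply: le_trans (Re_le_normc _) _; apply: le_trans (CS _ _) _.
rewrite -nrm_sqr expr2 mulrCA ler_wpM2l ?nrm_ge0 //.
by have := h v hv; rewrite mul1r.
Qed.

(** A single number above 1, above every |c_j| and above G. The first two make it a valid [mu] and
    control the exponentials of the factors; the last controls the exact evolution, whose generator
    is a sum of G layers. *)
Definition growth_cst (l : seq (R * 'I_G)) : R :=
  1 + \sum_(x <- l) `|x.1| + G%:R.

Lemma list_error (l : seq (R * 'I_G)) (p : nat) (t : R) : (0 < p)%N -> 0 <= t ->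
  eqm p.+1 (fP p.+1 (lift_list layer l)) (fexp p.+1 (\sum_g layer g)) ->
  (forall g, H g \is hermsymmx) \/ t * eta%:R <= 1 ->
  let K := expR (growth_cst l * (2 * J0)) in
  opb (mexpt (\sum_g layer g) t - prodt (lift_list layer l) t)
    (K ^+ (size l).+2 * rem_cst K (growth_cst l) p (size l) *
     (nested_cst J0 k0 p k0 1 (2 * J0) * eta%:R) * t ^+ p.+1).
Proof.
move=> p0 t0 hord /(energy_bound t0) [b [b0 bt hb]] K.
set mu := growth_cst l; set B := nested_cst _ _ _ _ _ _ * _.
have S0 : 0 <= \sum_(x <- l) `|x.1| by exact: sumr_ge0.
have mu1 : 1 <= mu by rewrite /mu /growth_cst -addrA lerDl addr_ge0.
have mu0 : 0 <= mu := le_trans ler01 mu1.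
have B0 : 0 <= B by rewrite mulr_ge0 ?nested_cst_ge0 ?mulr_ge0.
have K1 : 1 <= K by rewrite -expR0 ler_expR !mulr_ge0.
have small (x : R) : 0 <= x <= mu -> expR (x * b * t) <= K.
  move=> /andP[x0 xm]; rewrite ler_expR -mulrA; apply: ler_pM => //.
  by rewrite mulr_ge0.
have hl : forall x, x \in l -> `|x.1| <= mu.
  move=> x xl; rewrite /mu /growth_cst (big_rem x) //=.
  have h1 : 0 <= \sum_(y <- rem x l) `|y.1| by exact: sumr_ge0.
  have h2 : 0 <= G%:R :> R by [].
  have gen (u v w : R) : 0 <= u -> 0 <= w -> v <= 1 + (v + u) + w by move=> *; lra.
  exact: gen.
have hadm : all_adm Ntot eta%:R layer t K B mu p (lift_list layer l).
  rewrite /lift_list; elim: (l) hl => //= x s ih hs; split; last first.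
    by apply: ih => y ys; apply: hs; rewrite inE ys orbT.
  have hx : `|x.1| <= mu by apply: hs; rewrite mem_head.
  split.
  + exact/commrZ/comm_layer.
  + apply: nest_le (nestZ _ (nest_layer _ p0)).
    by rewrite normc_real ler_wpM2r.
  + move=> r Y c c0 /= [_ hY]; rewrite brkZl.
    by apply: nest_le (nestZ _ (hY x.2)); rewrite normc_real ler_wpM2r.
  move=> s0 hs0; apply: (@opb_le _ _ _ _ _ (expR (`|x.1| * b * t))).
    by apply: small; rewrite normr_ge0.
  apply: opb_mexpt_abs => //.
  + by rewrite mulr_ge0.
  + exact/commrZ/comm_layer.
  move=> v hv; rewrite -scalemxAl dotZr Re_realM normrM -mulrA ler_wpM2l //.
  exact: hb.
have hcomm : GRing.comm Ntot (\sum_g layer g).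
  by apply: commr_sum => g _; exact: comm_layer.
have hexp s : `|s| <= t -> opb (mexpt (\sum_g layer g) s) K.
  move=> hs; apply: (@opb_le _ _ _ _ _ (expR (G%:R * b * t))).
    by apply: small; rewrite ler0n /mu /growth_cst lerDr addr_ge0.
  apply: opb_mexpt_abs => //; first by rewrite mulr_ge0.
  move=> v hv; rewrite mulmx_suml.
  have -> : Re (dot v (\sum_g layer g *m v)) = \sum_g Re (dot v (layer g *m v)).
    by rewrite -Re_sum /dot mulmx_sumr summxE.
  apply: le_trans (ler_norm_sum _ _ _) _.
  apply: le_trans (ler_sum _ (fun g _ => hb g v hv)) _.
  by rewrite sumr_const card_ord -[leLHS]mulr_natl mulrA.
have := product_formula_error t0 K1 B0 mu1 p0 hadm hcomm hexp hord.
by rewrite size_map.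
Qed.

Lemma formula_error (p : nat) (t : R) : product_order p -> 0 <= t ->
  (forall g, H g \is hermsymmx) \/ t * eta%:R <= 1 ->
  let l := pf_list R G p in
  let K := expR (growth_cst l * (2 * J0)) in
  opb (evol (\sum_g H g) t - product_formula (fun g => H g) p t)
    (K ^+ (size l).+2 * rem_cst K (growth_cst l) p (size l) *
     (nested_cst J0 k0 p k0 1 (2 * J0) * eta%:R) * t ^+ p.+1).
Proof.
move=> hp t0 hH l K.
have p0 : (0 < p)%N by case: hp => [->|[]].
have hX g : layer g = Complex 0 (-1) *: H g by [].
have -> : evol (\sum_g H g) t = mexpt (\sum_g layer g) t.
  rewrite /evol /mexpt neg_imag -scalerA scaler_sumr.
  by congr (mexp (_ *: _)); apply: eq_bigr.
rewrite (product_formulaE hX); exact: list_error p0 t0 (pf_order layer hp) hH.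
Qed.

Lemma eta_norm_le (X : A) (c : R) : 0 <= c -> opb X c -> eta_norm a eta X <= c.
Proof.
move=> c0 [_ hX]; rewrite /eta_norm; set S := (X in sup X).
have ubS : ubound S c.
  move=> r [psi [phi [[n1 _] [n2 s2] ->]]].
  have nrm1 (v : 'cV[C]_n.+1) : v^t* *m v = 1%:M -> nrm v = 1.
    by move=> e; rewrite /nrm /nsq /dot e mxE eqxx /= sqrtr1.
  rewrite -mulmxA; apply: le_trans (CS psi (X *m phi)) _.
  by rewrite nrm1 // mul1r; apply: le_trans (hX phi s2) _; rewrite nrm1 // mulr1.
(* Without states in the sector the supremum is that of the empty set, namely 0, which is at most
   [c] by assumption. *)
have [/eqP S0|/set0P nS] := eqVneq S classical_sets.set0.
  by rewrite (eqP S0) sup0.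
exact: ge_sup.
Qed.

End Hamiltonian.

End Assembly.

Theorem corollary26 (R : realType) (p G : nat) (hp : product_order p)
    (J : 'I_G -> R) (k : 'I_G -> nat) :
  exists C : R,
  forall (V : zmodType) (B : Type) (M : finType) (pos : M -> V * B)
    (D : nat) (a : M -> 'M[R[i]]_D)
    (m : 'I_G -> nat) (hc : 'I_G -> bool)
    (F : forall g : 'I_G, {set (k g).-tuple M}),
  injective pos ->
  CAR a ->
  (forall g, ((m g).*2 <= k g)%N) ->
  (forall g s, s \in F g -> uniq s) ->
  (forall g, translation_invariant pos (F g)) ->
  (forall g, disjoint_supports (F g)) ->
  let H g := ham_layer a (J g) (hc g) (m g) (F g) in
  forall (eta : nat) (t : R), 0 <= t ->
  (forall g, H g \is hermsymmx) \/ t * eta%:R <= 1 ->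
  eta_norm a eta (evol (\sum_g H g) t - product_formula H p t)
    <= C * t ^+ p.+1 * eta%:R.
Proof.
pose l := pf_list R G p.
pose J0 := \sum_g `|J g|.
pose k0 := (\sum_g k g)%N.
pose K := expR (growth_cst l * (2 * J0)).
(* The constant is assembled from p, G, J and k alone, before any lattice or representation is
   introduced. *)
pose c := K ^+ (size l).+2 * rem_cst K (growth_cst l) p (size l) *
          nested_cst J0 k0 p k0 1 (2 * J0).
have J00 : 0 <= J0 by exact: sumr_ge0.
have K1 : 1 <= K by rewrite -expR0 ler_expR !mulr_ge0 // !addr_ge0 // sumr_ge0.
have mu1 : 1 <= growth_cst l by rewrite /growth_cst -addrA lerDl addr_ge0 // sumr_ge0.
have c0 : 0 <= c.
  apply: mulr_ge0; last by rewrite nested_cst_ge0 ?mulr_ge0.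
  by apply: mulr_ge0; [rewrite exprn_ge0 ?expR_ge0 | exact: rem_cst_ge0].
exists c => V B M pos [|n] a m hc F _ car hm _ _ hF H eta t t0 hH.
  (* In dimension 0 no vector is normalized, so the norm is the supremum of the empty set. *)
  rewrite /eta_norm (_ : [set _ | _] = classical_sets.set0)%classic; last first.
    apply/seteqP; split=> // r [psi [phi [[/matrixP e _] _ _]]].
    have := e ord0 ord0.
    by rewrite !mxE big_ord0 eqxx => /eqP; rewrite eq_sym oner_eq0.
  by rewrite sup0; apply: mulr_ge0 => //; apply: mulr_ge0 => //; exact: exprn_ge0.
apply: eta_norm_le.
  by apply: mulr_ge0 => //; apply: mulr_ge0 => //; exact: exprn_ge0.
have swap (x y z w : R) : x * (y * z) * w = x * y * w * z by ring.
by have := formula_error car hm hF hp t0 hH; cbv zeta; rewrite swap.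
Qed.
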